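(* Let $q\in(0,1)$. For every $\delta>0$ there are $N\in\mathbb N$, $\theta\in\mathbb R^N$, and a positive definite correlation matrix $\Sigma\in\mathbb R^{N\times N}$ (symmetric, positive definite, unit diagonal) such that, for $T\sim N(\theta,\Sigma)$, $$\mathrm{FDR}_{\theta,\Sigma}(\mathrm{BH}_q)>\ell_{=}(q)-\delta,$$ where $\mathrm{FDR}_{\theta,\Sigma}(\mathrm{BH}_q)$ is the false discovery rate of the level-$q$ Benjamini–Hochberg procedure applied to the two-sided $p$-values $p(|T_1|),\dots,p(|T_N|)$ for the hypotheses $H_i:\theta_i=0$. Consequently, $$\sup_{N\in\mathbb N,\ \theta\in\mathbb R^N,\ \Sigma\succ0,\ \mathrm{diag}(\Sigma)=\mathbf 1_N}\mathrm{FDR}_{\theta,\Sigma}(\mathrm{BH}_q)\ \ge\ \ell_{=}(q).$$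
   Context: $\Phi,\phi$ are the standard normal CDF and density, $\overline\Phi=1-\Phi$, and $p(x)=2\overline\Phi(x)$. Benjamini–Hochberg procedure at level $q$ ($\mathrm{BH}_q$): given $p$-values $P_1,\dots,P_N$ with order statistics $P_{(1)}\le\dots\le P_{(N)}$, put $R=\max\{1\le k\le N: P_{(k)}\le qk/N\}$ ($R=0$ if the set is empty) and reject the hypotheses corresponding to $P_{(1)},\dots,P_{(R)}$. If $V$ is the number of rejected true null hypotheses, $\mathrm{FDP}=V/(R\vee1)$ and $\mathrm{FDR}=\mathbb E(\mathrm{FDP})$. Here $H_i$ is a true null iff $\theta_i=0$. Define, for $y\ge0$, $M(y)=\sup_{a\ge0}e^{-a^2/2}\cosh(ay)$. One has $M=1$ on $[0,1]$, and $M$ is continuous, strictly increasing and unbounded on $(1,\infty)$; so for $q\in(0,1)$ there is a unique $y_q>1$ with $qM(y_q)=1$. Define $$\ell_{=}(q)=q\Phi(1)+q\int_1^{y_q}M(y)\phi(y)\,dy+\overline\Phi(y_q).$$ *)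

(* Defs.v *)
From HB Require Import structures.
From mathcomp Require Import all_boot all_order all_algebra.
From mathcomp Require Import all_classical all_reals all_analysis.
From mathcomp Require Import measurable_realfun ring lra.

Set Implicit Arguments.
Unset Strict Implicit.
Unset Printing Implicit Defensive.

Import Order.TTheory GRing.Theory Num.Theory.
Import numFieldNormedType.Exports.

Local Open Scope classical_set_scope.
Local Open Scope ring_scope.

Section lebesgue_tuple.
Context {R : realType}.
Local Notation mu := (@lebesgue_measure R).

Definition tuple_cons n (p : measurableTypeR R * n.-tuple (measurableTypeR R)) :
  n.+1.-tuple (measurableTypeR R) := [tuple of p.1 :: p.2].

(* Lebesgue measure on R^n (lambda^(n+1) = lambda (x) lambda^n); tuples are
   used because they carry the product sigma-algebra in the library.          *)
Fixpoint lebesgue_tuple n : set (n.-tuple (measurableTypeR R)) -> \bar R :=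
  if n is m.+1 then pushforward (mu \x @lebesgue_tuple m)%E (@tuple_cons m)
  else \d_([tuple] : 0.-tuple (measurableTypeR R)).

Arguments lebesgue_tuple : clear implicits.

Lemma measurable_tuple_cons n : measurable_fun setT (@tuple_cons n).
Proof. exact: measurable_cons. Qed.

HB.instance Definition _ n :=
  isMeasurableFun.Build _ _ _ _ (@tuple_cons n) (@measurable_tuple_cons n).

Definition tuple_uncons n (t : n.+1.-tuple (measurableTypeR R)) :
  measurableTypeR R * n.-tuple (measurableTypeR R) :=
  (thead t, [tuple of behead t]).

Lemma measurable_tuple_uncons n : measurable_fun setT (@tuple_uncons n).
Proof.
apply/measurable_fun_pairP; split; first exact: measurable_tnth.
apply/measurable_fun_tnthP => i.
rewrite (_ : _ \o _ = (fun t => tnth t (lift ord0 i))); first exact: measurable_tnth.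
by apply/funext => t /=; rewrite tnth_behead; congr tnth; apply/val_inj; rewrite /= inordK// ltnS.
Qed.

Lemma tuple_consK n : cancel (@tuple_cons n) (@tuple_uncons n).
Proof. by move=> [x t]; congr pair; apply/val_inj. Qed.

Lemma tuple_unconsK n : cancel (@tuple_uncons n) (@tuple_cons n).
Proof. by move=> t; rewrite [RHS]tuple_eta. Qed.

Lemma lebesgue_tuple_spec n :
  {m : {sigma_finite_measure set (n.-tuple (measurableTypeR R)) -> \bar R} |
     lebesgue_tuple n = m}.
Proof.
elim: n => [|n [m mE]].
  by exists (\d_([tuple] : 0.-tuple (measurableTypeR R))).
pose m' := pushforward (mu \x m)%E (@tuple_cons n).
have sf : sigma_finite setT m'.
  have /sigma_finiteP[F [TF ndF Foo]] := sigma_finiteT mu.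
  have /sigma_finiteP[G [TG ndG Goo]] := sigma_finiteT m.
  exists (fun k => @tuple_uncons n @^-1` (F k `*` G k)).
    apply/seteqP; split => // t _.
    have [k1 _ F1] : (\bigcup_k F k) (tuple_uncons t).1 by rewrite -TF.
    have [k2 _ G2] : (\bigcup_k G k) (tuple_uncons t).2 by rewrite -TG.
    exists (maxn k1 k2) => //; split.
      by move: F1; exact/subsetPset/ndF/leq_maxl.
    by move: G2; exact/subsetPset/ndG/leq_maxr.
  move=> k; have [mF Fk] := Foo k; have [mG Gk] := Goo k; split.
    rewrite -[X in measurable X]setTI.
    by apply: measurable_tuple_uncons => //; exact: measurableX.
  rewrite /m' /pushforward -comp_preimage.
  rewrite (_ : _ \o _ = id) ?preimage_id; last first.
    by apply/funext => p /=; rewrite tuple_consK.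
  by rewrite product_measure1E// lte_mul_pinfty// ge0_fin_numE.
pose pm : {measure set _ -> \bar R} :=
  measure_function_pushforward__canonical__measure_function_Measure
    (mu \x m)%E (@measurable_tuple_cons n).
pose H := Measure_isSigmaFinite.Build _ _ _ pm sf.
pose M : {sigma_finite_measure set _ -> \bar R} :=
  HB.pack (Measure.sort pm) H (Measure.class pm).
by exists M; rewrite /= mE.
Qed.

Let lebesgue_tuple0 n : lebesgue_tuple n set0 = 0%E.
Proof. by have [m ->] := lebesgue_tuple_spec n. Qed.

Let lebesgue_tuple_ge0 n A : (0 <= lebesgue_tuple n A)%E.
Proof. by have [m ->] := lebesgue_tuple_spec n. Qed.

Let lebesgue_tuple_sigma_additive n : semi_sigma_additive (lebesgue_tuple n).
Proof.
by have [m ->] := lebesgue_tuple_spec n; exact: measure_semi_sigma_additive.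
Qed.

HB.instance Definition _ n := isMeasure.Build _ _ _ (lebesgue_tuple n)
  (lebesgue_tuple0 n) (@lebesgue_tuple_ge0 n) (@lebesgue_tuple_sigma_additive n).

Let lebesgue_tuple_sigma_finite n : sigma_finite setT (lebesgue_tuple n).
Proof. by have [m ->] := lebesgue_tuple_spec n; exact: sigma_finiteT. Qed.

HB.instance Definition _ n := Measure_isSigmaFinite.Build _ _ _
  (lebesgue_tuple n) (lebesgue_tuple_sigma_finite n).

Lemma ge0_integral_lebesgue_tupleS n
    (f : n.+1.-tuple (measurableTypeR R) -> \bar R) :
  measurable_fun [set: n.+1.-tuple (measurableTypeR R)] f -> (forall t, 0 <= f t)%E ->
  (\int[lebesgue_tuple n.+1]_t f t =
   \int[mu]_x \int[lebesgue_tuple n]_t f (tuple_cons (x, t)))%E.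
Proof.
move=> mf f0.
have := @ge0_integral_pushforward _ _ _ _ _ _ (@measurable_tuple_cons n)
  (mu \x lebesgue_tuple n)%E setT f measurableT mf (fun t _ => f0 t).
rewrite preimage_setT => ->.
rewrite (@fubini_tonelli1 _ _ _ _ _ mu (lebesgue_tuple n))//.
  exact: measurableT_comp.
by move=> p; exact: f0.
Qed.

End lebesgue_tuple.
Arguments lebesgue_tuple : clear implicits.

Section multivariate_normal.
Context {R : realType}.

Definition posdefmx n (S : 'M[R]_n) :=
  S^T = S /\ forall v : 'rV[R]_n, v != 0 -> 0 < (v *m S *m v^T) 0 0.

Definition row_of_tuple n (t : n.-tuple (measurableTypeR R)) : 'rV[R]_n :=
  \row_i tnth t i.

Definition mvn_pdf n (theta : 'rV[R]_n) (Sigma : 'M[R]_n)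
    (t : n.-tuple (measurableTypeR R)) : R :=
  let x := row_of_tuple t - theta in
  (Num.sqrt ((2 * pi) ^+ n * \det Sigma))^-1 *
  expR (- (x *m invmx Sigma *m x^T) 0 0 / 2).

(* The law N(theta, Sigma), for Sigma positive definite. *)
Definition mvn_prob n (theta : 'rV[R]_n) (Sigma : 'M[R]_n) :
    set (n.-tuple (measurableTypeR R)) -> \bar R :=
  fun A => (\int[lebesgue_tuple R n]_(t in A) (mvn_pdf theta Sigma t)%:E)%E.

Lemma mvn_pdf_ge0 n (theta : 'rV[R]_n) Sigma t : 0 <= mvn_pdf theta Sigma t.
Proof. by rewrite mulr_ge0 ?invr_ge0 ?sqrtr_ge0 ?expR_ge0. Qed.

Lemma measurable_mvn_pdf n (theta : 'rV[R]_n) Sigma :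
  measurable_fun setT (mvn_pdf theta Sigma).
Proof.
have mx i : measurable_fun [set: n.-tuple (measurableTypeR R)]
    (fun t => (row_of_tuple t - theta) 0 i).
  under eq_fun do rewrite !mxE.
  by apply: measurable_funB => //; exact: measurable_tnth.
apply: measurable_funM; first exact: measurable_cst.
apply: measurableT_comp => //; apply: measurable_funM => //.
apply: measurableT_comp => //; under eq_fun do rewrite mxE.
apply: measurable_sum => i; apply: measurable_funM.
  under eq_fun do rewrite mxE.
  by apply: measurable_sum => j; apply: measurable_funM.
under eq_fun do rewrite mxE.
exact: mx.
Qed.

Section mvn_measure.
Variables (n : nat) (theta : 'rV[R]_n) (Sigma : 'M[R]_n).

Let mvn_prob0 : mvn_prob theta Sigma set0 = 0%E.
Proof. by rewrite /mvn_prob integral_set0. Qed.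

Let mvn_prob_ge0 A : (0 <= mvn_prob theta Sigma A)%E.
Proof. by apply: integral_ge0 => t _; rewrite lee_fin mvn_pdf_ge0. Qed.

Let mvn_prob_sigma_additive : semi_sigma_additive (mvn_prob theta Sigma).
Proof.
move=> /= F mF tF mUF; rewrite /mvn_prob ge0_integral_bigcup//=; last 2 first.
  by apply/measurable_EFinP/measurable_funTS; exact: measurable_mvn_pdf.
  by move=> t _; rewrite lee_fin mvn_pdf_ge0.
apply: is_cvg_ereal_nneg_natsum_cond => k _ _.
by apply: integral_ge0 => t _; rewrite lee_fin mvn_pdf_ge0.
Qed.

HB.instance Definition _ := isMeasure.Build _ _ _
  (mvn_prob theta Sigma) mvn_prob0 mvn_prob_ge0 mvn_prob_sigma_additive.

End mvn_measure.


Lemma posdefmx_unit n (S : 'M[R]_n) : posdefmx S -> S \in unitmx.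
Proof.
move=> [_ S0]; rewrite unitmxE unitfE; apply/det0P => -[v v0 vS].
by have := S0 _ v0; rewrite vS mul0mx mxE ltxx.
Qed.

Section block.
Variables (n : nat) (S : 'M[R]_(1 + n)).
Hypothesis S_posdef : posdefmx S.
Let a : R := S 0 0.
Let b : 'rV[R]_n := ursubmx S.
Let D : 'M[R]_n := drsubmx S.
Let S' : 'M[R]_n := D - a^-1 *: (b^T *m b).

Let SE : S = block_mx a%:M b b^T D.
Proof.
have [ST _] := S_posdef.
rewrite -[LHS]submxK; congr block_mx.
  rewrite [LHS]mx11_scalar; congr (_%:M); rewrite !mxE; congr (S _ _); exact/val_inj.
by rewrite /b -{1}ST trmx_ursub.
Qed.

Let DT : D^T = D.
Proof. by have [ST _] := S_posdef; rewrite /D -[in RHS]ST trmx_drsub. Qed.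

Lemma posdefmx_ul_gt0 : 0 < a.
Proof.
have [_ /(_ (row_mx 1%:M 0))] := S_posdef.
rewrite SE mul_row_block tr_row_mx mul_row_col !mul0mx !mul1mx trmx0 mulmx0.
rewrite !addr0 trmx1 mulmx1.
have -> : (a%:M : 'M[R]_1) 0 0 = a by rewrite mxE.
apply.
apply/eqP => /(congr1 lsubmx); rewrite row_mxKl linear0.
by move=> /matrixP/(_ 0 0)/eqP; rewrite !mxE oner_eq0.
Qed.

Lemma posdefmx_schur : posdefmx S'.
Proof.
have a0 := lt0r_neq0 posdefmx_ul_gt0.
split.
  by rewrite /S' linearB linearZ /= trmx_mul trmxK DT.
move=> v v0; have [_ /(_ (row_mx (- a^-1 *: (v *m b^T)) v))] := S_posdef.
rewrite SE mul_row_block.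
rewrite mul_mx_scalar scalerA mulrN divff// scaleN1r addNr.
rewrite tr_row_mx mul_row_col mul0mx add0r.
have -> : - a^-1 *: (v *m b^T) *m b + v *m D = v *m S'.
  by rewrite scaleNr mulNmx -scalemxAl -mulmxA /S' mulmxBr -scalemxAr addrC.
apply.
apply/eqP => /(congr1 rsubmx); rewrite row_mxKr linear0.
exact/eqP.
Qed.

Lemma det_posdefmx_block : \det S = a * \det S'.
Proof.
have a0 := lt0r_neq0 posdefmx_ul_gt0.
rewrite [in LHS]SE.
have -> : block_mx a%:M b b^T D =
    block_mx a%:M 0 b^T S' *m block_mx 1%:M (a^-1 *: b) 0 1%:M.
  rewrite mulmx_block !mulmx0 !mulmx1 !addr0 mul_scalar_mx scalerA divff//.
  by rewrite scale1r -scalemxAr /S' addrC subrK.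
by rewrite det_mulmx det_lblock det_ublock !det1 !mulr1 det_scalar1.
Qed.

Lemma quad_posdefmx_block (w : 'rV[R]_1) (x : 'rV[R]_n) :
  (row_mx w x *m invmx S *m (row_mx w x)^T) 0 0 = (w 0 0) ^+ 2 / a +
  let r := x - (w 0 0 / a) *: b in (r *m invmx S' *m r^T) 0 0.
Proof.
have a0 := lt0r_neq0 posdefmx_ul_gt0.
set c := w 0 0; set r := x - _.
have wE : w = c%:M by rewrite [LHS]mx11_scalar.
pose u2 := r *m invmx S'.
pose u1 : 'rV[R]_1 := a^-1 *: (w - u2 *m b^T).
have uS : row_mx u1 u2 *m S = row_mx w x.
  rewrite [in LHS]SE mul_row_block; congr row_mx.
    by rewrite mul_mx_scalar scalerA divff// scale1r subrK.
  have -> : D = S' + a^-1 *: (b^T *m b) by rewrite subrK.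
  rewrite mulmxDr mulmxKV ?posdefmx_unit//; last exact: posdefmx_schur.
  rewrite /u1 -scalemxAl mulmxBl -scalemxAr mulmxA scalerBr wE mul_scalar_mx.
  rewrite scalerA [a^-1 * c]mulrC. 
  by rewrite [r + _]addrC addrA subrK addrC subrK.
rewrite -{1}uS mulmxK ?posdefmx_unit// tr_row_mx mul_row_col.
rewrite [LHS]mxE /u1 -scalemxAl mulmxBl scalerBr.
have -> : x = r + (c / a) *: b by rewrite subrK.
have -> : (r + (c / a) *: b)^T = r^T + (c / a) *: b^T by rewrite linearD linearZ.
rewrite mulmxDr -scalemxAr -/u2.
rewrite wE tr_scalar_mx !mul_mx_scalar scale_scalar_mx.
rewrite scalerA [a^-1 * c]mulrC !mxE eqxx !mulr1n.
by rewrite expr2 -/c; lra.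
Qed.

End block.

Lemma mvn_pdf_cons n (theta : 'rV[R]_(1 + n)) (Sigma : 'M[R]_(1 + n)) x t :
  posdefmx Sigma ->
  let c := Sigma 0 0 in
  let b : 'rV[R]_n := ursubmx Sigma in
  mvn_pdf theta Sigma (tuple_cons (x, t) : (1 + n).-tuple _) =
  normal_pdf (theta 0 0) (Num.sqrt c) x *
  mvn_pdf (rsubmx theta + ((x - theta 0 0) / c) *: b)
    (drsubmx Sigma - c^-1 *: (b^T *m b)) t.
Proof.
move=> S0 c b; have c0 : 0 < c := posdefmx_ul_gt0 S0.
have rowE : row_of_tuple (tuple_cons (x, t) : (1 + n).-tuple _) - theta =
    row_mx (x - theta 0 0)%:M (row_of_tuple t - rsubmx theta).
  apply/rowP => i; rewrite -(splitK i); case: (fintype.split i) => j /=.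
    rewrite row_mxEl !mxE ord1 eqxx mulr1n (_ : lshift n 0 = ord0)//.
    exact/val_inj.
  rewrite row_mxEr !mxE (_ : rshift 1 j = lift ord0 j); last exact/val_inj.
  by rewrite tnthS.
rewrite [LHS]/mvn_pdf rowE quad_posdefmx_block// det_posdefmx_block//.
rewrite normal_pdfE ?gt_eqF ?sqrtr_gt0// /normal_peak /normal_fun.
rewrite sqr_sqrtr ?ltW// /mvn_pdf -/c -/b.
rewrite mxE eqxx mulr1n.
set u := x - theta 0 0.
rewrite [row_of_tuple t - (rsubmx theta + _)](_ : _ = row_of_tuple t - rsubmx theta - (u / c) *: b); last first.
  by rewrite opprD addrA.
set S' := drsubmx Sigma - _.
set r := row_of_tuple t - _ - _.
set Q := (r *m _ *m _) 0 0.
rewrite mulrACA -expRD -invfM -sqrtrM; last first.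
  by rewrite mulrn_wge0// mulr_ge0 ?pi_ge0// ltW.
congr (_^-1 * expR _); first by congr Num.sqrt; rewrite exprS -mulr_natl; ring.
by field; rewrite gt_eqF.
Qed.

Lemma integral_mvn_pdf n (theta : 'rV[R]_n) (Sigma : 'M[R]_n) :
  posdefmx Sigma ->
  (\int[lebesgue_tuple R n]_t (mvn_pdf theta Sigma t)%:E = 1)%E.
Proof.
elim: n => [|n IH] in theta Sigma * => S0.
  rewrite /= integral_dirac//; last first.
    by apply/measurable_EFinP; exact: measurable_mvn_pdf.
  rewrite diracT mul1e /mvn_pdf expr0 mul1r det_mx00 sqrtr1 invr1 mul1r.
  by rewrite mxE big_ord0 oppr0 mul0r expR0.
rewrite ge0_integral_lebesgue_tupleS; last 2 first.
  by apply/measurable_EFinP; exact: measurable_mvn_pdf.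
  by move=> t; rewrite lee_fin mvn_pdf_ge0.
rewrite -[RHS](integral_normal_pdf (theta 0 0) (Num.sqrt (Sigma 0 0))).
apply: eq_integral => x _.
under eq_integral do rewrite (mvn_pdf_cons _ _ _ S0) EFinM.
rewrite ge0_integralZl//=; last 3 first.
  by apply/measurable_EFinP; exact: measurable_mvn_pdf.
  by move=> t _; rewrite lee_fin mvn_pdf_ge0.
  by rewrite lee_fin normal_pdf_ge0.
by rewrite IH ?mule1//; exact: posdefmx_schur S0.
Qed.

Lemma mvn_prob_setT n (theta : 'rV[R]_n) (Sigma : 'M[R]_n) :
  posdefmx Sigma -> mvn_prob theta Sigma setT = 1%E.
Proof. exact: integral_mvn_pdf. Qed.

End multivariate_normal.

Section standard_normal.
Context {R : realType}.

Definition Phi (x : R) : R := fine (normal_prob 0 1 `]-oo, x]).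

Definition phi (x : R) : R := normal_pdf 0 1 x.

Definition pvalue (x : R) : R := 2 * (1 - Phi x).

Lemma measurable_pvalue : measurable_fun [set: measurableTypeR R] pvalue.
Proof.
apply: measurable_funM => //; apply: measurable_funB => //.
apply: nondecreasing_measurable => // x y xy; rewrite fine_le ?fin_num_measure//.
apply: le_measure; rewrite ?inE//.
by apply: subset_itvl; rewrite bnd_simp.
Qed.

End standard_normal.

Section benjamini_hochberg.
Context {R : realType} {N : nat}.
Implicit Types (q : R) (P : 'I_N -> R) (theta : 'rV[R]_N).

(* P_(k), for 1 <= k <= N. *)
Definition order_stat P (k : nat) : R := nth 0 (sort <=%R (codom P)) k.-1.

(* R; the maximum over the empty set is 0. *)
Definition BH_num q P : nat :=
  \max_(k < N.+1 | (0 < k)%N && (order_stat P k <= q * k%:R / N%:R)) k.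

(* The hypotheses corresponding to P_(1), ..., P_(R): by maximality of R, no
   p-value beyond these can tie with P_(R).                                   *)
Definition BH_rejected q P : {set 'I_N} :=
  [set i | (0 < BH_num q P)%N && (P i <= order_stat P (BH_num q P))]%SET.

Definition FDP q theta P : R :=
  #|[set i in BH_rejected q P | theta 0 i == 0]%SET|%:R /
  (maxn (BH_num q P) 1)%:R.

Let below P c : {set 'I_N} := [set i | P i <= c]%SET.

Let order_stat_le P c k : (0 < k <= N)%N ->
  (order_stat P k <= c) = (k <= #|below P c|)%N.
Proof.
case: k => // k /= kN; rewrite /order_stat /=.
have ss : sorted <=%R (sort <=%R (codom P)) by exact: sort_le_sorted.
have -> : #|below P c| = count (<= c) (sort <=%R (codom P)).
  rewrite count_sort count_map -size_filter cardE [in LHS]/enum_mem -enumT.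
  by congr size; apply: eq_filter => i; rewrite /= inE.
have [kc|kc] := ltnP; first exact: nth_count_le.
apply/negbTE; rewrite -ltNge; apply: nth_count_gt => //.
by rewrite kc size_sort size_codom card_ord.
Qed.

Let BH_numE q P : BH_num q P =
  \max_(k < N.+1 | (0 < k <= #|below P (q * k%:R / N%:R)|)%N) k.
Proof.
apply: eq_bigl => k; have [k0|//] := ltnP 0 k.
by rewrite /= order_stat_le// k0 -ltnS ltn_ord.
Qed.

Let BH_rejectedE q P : 0 <= q -> BH_rejected q P =
  [set i in below P (q * (BH_num q P)%:R / N%:R) | (0 < BH_num q P)%N]%SET.
Proof.
move=> q0; apply/setP => i; rewrite !inE andbC.
have [r0|] := ltnP 0 (BH_num q P); last by rewrite !andbF.
rewrite !andbT.
have [k /andP[k0 kq] kE] : {k : 'I_N.+1 |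
    (0 < k)%N && (order_stat P k <= q * k%:R / N%:R) & BH_num q P = k}.
  apply: (@eq_bigmax_cond _ [pred k : 'I_N.+1 |
    (0 < k)%N && (order_stat P k <= q * k%:R / N%:R)]).
  rewrite lt0n; apply: contraTneq r0 => /card0_eq n0.
  rewrite -leqNgt; apply/bigmax_leqP => k kP.
  by have := n0 k; rewrite !inE kP.
rewrite kE; apply/idP/idP => [|Pi]; first by move/le_trans; apply.
have kN : (k <= N)%N by rewrite -ltnS.
rewrite leNgt; apply/negP => Pki.
have ck : (k < #|below P (q * k%:R / N%:R)|)%N.
  have : (k <= #|below P (order_stat P k)|)%N by rewrite -order_stat_le ?k0 ?kN.
  move/leq_ltn_trans; apply; apply: proper_card; apply/properP; split.
    by apply/fintype.subsetP => j; rewrite !inE => /le_trans; apply.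
  by exists i; rewrite !inE// -ltNge.
have k1N : (k.+1 < N.+1)%N.
  by rewrite ltnS (leq_trans ck)// -[leqRHS]card_ord max_card.
suff : (k.+1 <= BH_num q P)%N by rewrite kE ltnn.
apply: (@leq_bigmax_cond _ _ _ (Ordinal k1N)) => /=.
rewrite order_stat_le//; apply: leq_trans ck _.
apply/subset_leq_card/fintype.subsetP => j; rewrite !inE => /le_trans; apply.
by rewrite ler_wpM2r ?invr_ge0// ler_wpM2l// ler_nat.
Qed.

Lemma measurable_FDP d (T : measurableType d) q theta (P : 'I_N -> T -> R) :
  0 <= q -> (forall i, measurable_fun setT (P i)) ->
  measurable_fun setT (fun t => FDP q theta (P ^~ t)).
Proof.
move=> q0 mP.
pose g t : {ffun 'I_N.+1 -> {set 'I_N}} :=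
  [ffun k : 'I_N.+1 => below (P ^~ t) (q * k%:R / N%:R)].
pose num (f : {ffun 'I_N.+1 -> {set 'I_N}}) : nat :=
  \max_(k < N.+1 | (0 < k <= #|f k|)%N) k.
pose rej (f : {ffun 'I_N.+1 -> {set 'I_N}}) : {set 'I_N} :=
  [set i in f (inord (num f)) | (0 < num f)%N]%SET.
pose h (f : {ffun 'I_N.+1 -> {set 'I_N}}) : R :=
  #|[set i in rej f | theta 0 i == 0]%SET|%:R / (maxn (num f) 1)%:R.
have numE t : BH_num q (P ^~ t) = num (g t).
  by rewrite BH_numE; apply: eq_bigl => k; rewrite ffunE.
have num_le f : (num f < N.+1)%N.
  by rewrite ltnS; apply/bigmax_leqP => k _; rewrite -ltnS.
have FDPE : (fun t => FDP q theta (P ^~ t)) = h \o g.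
  apply/funext => t; rewrite /FDP /h /= BH_rejectedE// numE.
  congr (_%:R / _); apply: eq_card => i; rewrite !inE ffunE inordK//.
  by rewrite inE.
rewrite FDPE => _ Y mY; rewrite setTI.
rewrite (_ : _ @^-1` Y = \bigcup_(f in [set f | Y (h f)]) (g @^-1` [set f])); last first.
  by apply/seteqP; split => [t /= Yt|t [f Yf] /= ->//]; exists (g t).
apply: fin_bigcup_measurable => [|f _]; first exact: finite_finset.
rewrite (_ : _ @^-1` _ = \bigcap_(ki in [set: 'I_N.+1 * 'I_N])
    [set t | (ki.2 \in f ki.1) = (P ki.2 t <= q * ki.1%:R / N%:R)]); last first.
  apply/seteqP; split => [t /= gf [k i] _ /=|t /= fP].
    by rewrite -gf ffunE inE.
  by apply/ffunP => k; apply/setP => i; rewrite ffunE inE -(fP (k, i) I).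
apply: fin_bigcap_measurable => [|[k i] _ /=]; first exact: finite_finset.
have mle : measurable [set t | P i t <= q * k%:R / N%:R].
  have := mP i measurableT _ (measurable_itv `]-oo, (q * k%:R / N%:R)]).
  congr measurable; apply/seteqP; split => [t [_]|t Pt]; first by rewrite /= in_itv.
  by split => //; rewrite /= in_itv.
case: (i \in f k).
  rewrite (_ : [set t | _] = [set t | P i t <= q * k%:R / N%:R])//.
  by apply/seteqP; split => t /=; [move=> <-|move=> ->].
rewrite (_ : [set t | _] = ~` [set t | P i t <= q * k%:R / N%:R]).
  exact: measurableC.
by apply/seteqP; split => t /=; [move=> <-|move/negP/negbTE => ->].
Qed.

End benjamini_hochberg.

Section fdr.
Context {R : realType}.
Implicit Types q : R.

Definition two_sided_pvalues N (t : N.-tuple (measurableTypeR R)) (i : 'I_N) : R :=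
  pvalue `|tnth t i|.

(* Expectation of the FDP under the law N(theta, Sigma); expectation_FDP below
   shows that this is 'E_P[FDP] for every random vector T ~ N(theta, Sigma).  *)
Definition FDR q N (theta : 'rV[R]_N) (Sigma : 'M[R]_N) : \bar R :=
  (\int[mvn_prob theta Sigma]_t (FDP q theta (two_sided_pvalues t))%:E)%E.

Lemma expectation_FDP q N (theta : 'rV[R]_N) (Sigma : 'M[R]_N)
    d (Omega : measurableType d) (P : probability Omega R)
    (T : {RV P >-> N.-tuple (measurableTypeR R)}) :
  0 <= q ->
  (forall A, measurable A -> distribution P T A = mvn_prob theta Sigma A) ->
  'E_P[fun w => FDP q theta (two_sided_pvalues (T w))]%E = FDR q theta Sigma.
Proof.
move=> q0 TE.
have -> : FDR q theta Sigma = (\int[distribution P T]_t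
    (FDP q theta (two_sided_pvalues t))%:E)%E.
  by apply: eq_measure_integral => A mA _; symmetry; exact: TE.
rewrite ge0_integral_distribution//; last 2 first.
- apply/measurable_EFinP; apply: measurable_FDP => // i.
  apply: (measurableT_comp measurable_pvalue).
  by apply: measurableT_comp => //; exact: measurable_tnth.
- by move=> t; rewrite lee_fin divr_ge0.
by rewrite unlock.
Qed.

Definition corrmx N (Sigma : 'M[R]_N) :=
  posdefmx Sigma /\ forall i, Sigma i i = 1.

Definition cosh (x : R) : R := (expR x + expR (- x)) / 2.

Definition M (y : R) : R :=
  sup [set expR (- a ^+ 2 / 2) * cosh (a * y) | a in [set a : R | 0 <= a]].

(* The number y_q; the default 0 is only taken if no such y exists. *)
Definition crit_y q : R := xget 0 [set y | 1 < y /\ q * M y = 1].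

Definition ell_eq q : R :=
  q * Phi 1 +
  q * \int[lebesgue_measure]_(y in `[1, crit_y q]) (M y * phi y) +
  (1 - Phi (crit_y q)).

End fdr.

(* Main.v *)
Require Import Defs.
From mathcomp Require Import all_boot all_order all_algebra.
From mathcomp Require Import all_classical all_reals all_analysis.
From mathcomp Require Import measurable_realfun ring lra.
Set Implicit Arguments.
Unset Strict Implicit.
Unset Printing Implicit Defensive.
Import Order.TTheory GRing.Theory Num.Theory.
Import numFieldNormedType.Exports.
Local Open Scope classical_set_scope.
Local Open Scope ring_scope.
Import HBNNSimple.

(** Put LR(a, z) = e^(-a^2/2) cosh(a z), so that M(z) is the supremum of LR(., z)
    over a >= 0.  Since M = 1 on [0,1] and q M(y_q) = 1, ell_=(q) is the
    expectation of the following function of a standard normal Z: it equals q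
    for Z <= 1, q M(Z) for 1 < Z < y_q, and 1 for Z > y_q.  The theorem holds
    because a one-factor model makes the conditional FDP given the factor Z
    almost as large as this function.

    In the model all statistics are conditionally independent given Z.  A true
    null has loading r, with r small: given Z = z it is N(r z, 1 - r^2).  At the
    threshold x = a/r its two-sided tail is about LR(a, z) p(x), because the
    densities of N(r z, 1 - r^2) at x and -x have average ratio LR(a, z) to the
    standard normal density ([normal_prob_two_sided_ge]).  Thus for the factor
    value z the nulls look, at the p-value level p(a/r), over-represented by
    LR(a, z).  As r tends to 0, distinct values of a live at p-value levels of
    different orders of magnitude, which is what allows each z to be served by
    its own a.

    Alternatives have a loading close to -1 and are therefore almost
    deterministic: T_j is about theta_j - Z.  Cut the range of Z into cells
    (y_k, y_(k+1)), choose an increasing sequence a_k, put x_k = a_k / r, and let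
    the alternatives come in groups, group l having mean x_l + y_(l+1).  For z in
    cell k the groups l >= k lie beyond x_k, while a group l < k lies below x_l.
    Let N be_k p(x_k) / q alternatives belong to the groups >= k.  If
    1 - be_k < q LR(a_k, z), then the nulls and these alternatives together put
    at least N p(x_k) / q p-values below p(x_k), so the procedure rejects at
    least that many hypotheses.  Whatever the final number of rejections is, at
    most a fraction be_k of them are alternatives: those of the groups >= k are
    too few, and reaching a group l < k requires a level p(x_l - e), which is
    much larger than p(x_l), for some fixed e > 0.  Hence FDP >= 1 - be_k
    ([FDP_good_event]).  A Chernoff bound for the nulls and a tail bound for the
    alternatives make this hold with probability close to 1 ([cond_FDP_ge]), and
    integrating over Z gives [FDR_cells_ge].

    It remains to choose cells.  With a_k a maximizer of LR(., y_k), which is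
    nondecreasing in y_k ([argmax_lik_ratio_mono]), one may take 1 - be_k close
    to q M(y_k) on a fine grid of [1, y_q]; a_0 close to 0 serves Z < 1 with
    1 - be_0 close to q, and a maximizer at y_q serves Z > y_q with 1 - be close
    to q M(y_q) = 1.  The resulting sum is a lower Riemann sum for ell_=(q). *)

(** * Integration against product densities *)

(** A measure with density g integrates f to the integral of f g: true for
    simple functions, then by monotone convergence. *)
Lemma ge0_integral_density (R : realType) (d : measure_display)
    (T : measurableType d) (mu nu : {measure set T -> \bar R}) (g : T -> R)
    (f : T -> \bar R) :
  measurable_fun setT g -> (forall t, 0 <= g t) ->
  (forall A, measurable A -> nu A = (\int[mu]_(t in A) (g t)%:E)%E) ->
  measurable_fun setT f -> (forall t, 0 <= f t)%E ->
  (\int[nu]_t f t = \int[mu]_t (f t * (g t)%:E))%E.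
Proof.
move=> mg g0 nuE mf f0.
pose h := nnsfun_approx measurableT mf.
have cvgh t : EFin (h n t) @[n --> \oo] --> f t by exact: cvg_nnsfun_approx.
have ndh t : {homo (fun n => EFin (h n t)) : m n / (m <= n)%N >-> (m <= n)%E}.
  by move=> m n mn; rewrite lee_fin; exact/lefP/nd_nnsfun_approx.
have mge : measurable_fun setT (EFin \o g) by exact/measurable_EFinP.
have mh n : measurable_fun setT (EFin \o h n) by exact/measurable_EFinP.
transitivity (limn (fun n => \int[nu]_t (h n t)%:E)%E).
  rewrite -monotone_convergence//; last by move=> n t _; rewrite lee_fin.
  by apply: eq_integral => t _; apply/esym/cvg_lim => //; exact: cvgh.
transitivity (limn (fun n => \int[mu]_t ((h n t)%:E * (g t)%:E))%E); last first.
  rewrite -monotone_convergence//; last 3 first.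
  - by move=> n; apply: emeasurable_funM; [exact: mh|exact: mge].
  - by move=> n t _; rewrite -EFinM lee_fin mulr_ge0.
  - by move=> t _ m n mn; rewrite lee_wpmul2r ?lee_fin//; exact: ndh.
  apply: eq_integral => t _; apply/cvg_lim => //.
  by apply: cvgeZr => //; exact: cvgh.
congr (limn _); apply/funext => n.
under eq_integral do rewrite fimfunE -fsumEFin//.
rewrite ge0_integral_fsum//; last 2 first.
- by move=> r; exact/measurable_EFinP/measurableT_comp.
- by move=> r t _; rewrite nnfun_muleindic_ge0.
under [RHS]eq_integral => t _.
  rewrite fimfunE -fsumEFin// ge0_mule_fsuml; last first.
    by move=> r; rewrite nnfun_muleindic_ge0.
  over.
rewrite ge0_integral_fsum//; last 2 first.
- move=> r; apply: emeasurable_funM => //.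
  exact/measurable_EFinP/measurableT_comp.
- by move=> r t _; rewrite mule_ge0 ?lee_fin//; exact: nnfun_muleindic_ge0.
apply: eq_fsbigr => r rh.
have mA : measurable (h n @^-1` [set r]) by exact: measurable_funPTI.
have r0 : 0 <= r by move: rh; rewrite inE => -[t _ <-].
under [RHS]eq_integral do rewrite EFinM -muleA.
rewrite ge0_integralZl//; last 2 first.
- apply: emeasurable_funM => //; exact/measurable_EFinP/measurable_indic.
- by move=> t _; rewrite mule_ge0// lee_fin.
rewrite integralZl_indic_nnsfun// integral_indic// setIT nuE//.
congr (_ * _)%E.
rewrite integral_mkcond; apply: eq_integral => t _.
by rewrite patchE indicE; case: (t \in _); rewrite ?mul1e ?mul0e.
Qed.

(** Independence in its only used form: integrals of products of functions of
    single coordinates factor. *)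
Lemma integral_tuple_prod (R : realType) n
    (g : nat -> measurableTypeR R -> R) (c : nat -> R) :
  (forall i, measurable_fun setT (g i)) -> (forall i x, 0 <= g i x) ->
  (forall i, (i < n)%N -> \int[lebesgue_measure]_x (g i x)%:E = (c i)%:E)%E ->
  (\int[lebesgue_tuple R n]_t (\prod_(i < n) g i (tnth t i))%:E =
   (\prod_(i < n) c i)%:E)%E.
Proof.
have mp m (f : nat -> measurableTypeR R -> R) : (forall i, measurable_fun setT (f i)) ->
    measurable_fun setT (fun t : m.-tuple (measurableTypeR R) =>
      (\prod_(i < m) f i (tnth t i))%:E).
  move=> mf; apply/measurable_EFinP; apply: measurable_prod => i _.
  by apply: (measurableT_comp (mf i)); exact: measurable_tnth.
elim: n => [|n IH] in g c *; move=> mg g0 gc.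
  rewrite /= integral_dirac//; first by rewrite diracT mul1e !big_ord0.
  exact: mp.
have tE x t : \prod_(i < n.+1) g i (tnth (tuple_cons (x, t)) i) =
    g 0%N x * \prod_(i < n) g i.+1 (tnth t i).
  by rewrite big_ord_recl; congr (_ * _); apply: eq_bigr => i _; rewrite tnthS.
rewrite ge0_integral_lebesgue_tupleS; last 2 first.
- exact: mp.
- by move=> t; rewrite lee_fin prodr_ge0.
have mgS : forall i, measurable_fun setT (g i.+1) by [].
transitivity (\int[lebesgue_measure]_x
    ((\prod_(i < n) c i.+1)%:E * (g 0%N x)%:E))%E.
  apply: eq_integral => x _.
  under eq_integral do rewrite tE EFinM.
  rewrite ge0_integralZl//; last 3 first.
  - exact: mp n _ mgS.
  - by move=> t _; rewrite lee_fin prodr_ge0.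
  - by rewrite lee_fin.
  by rewrite (IH (fun i => g i.+1) (fun i => c i.+1))//; [rewrite muleC|move=> i ?; exact: gc].
have c0 i : (i < n.+1)%N -> 0 <= c i.
  by move=> /gc h; rewrite -lee_fin -h integral_ge0// => x _; rewrite lee_fin.
rewrite ge0_integralZl//; last 3 first.
- exact/measurable_EFinP.
- by move=> x _; rewrite lee_fin.
- by rewrite lee_fin prodr_ge0// => i _; rewrite c0// ltnS.
by rewrite gc// -EFinM big_ord_recl mulrC.
Qed.

Lemma mvn_pdf_diag (R : realType) n (theta : 'rV[R]_n) (v : 'rV[R]_n) t :
  (forall i, 0 < v 0 i) ->
  mvn_pdf theta (diag_mx v) t =
  \prod_(i < n) normal_pdf (theta 0 i) (Num.sqrt (v 0 i)) (tnth t i).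
Proof.
move=> v0; have iE : invmx (diag_mx v) = diag_mx (\row_i (v 0 i)^-1).
  have vu : diag_mx v \in unitmx.
    rewrite unitmxE det_diag unitfE; apply/prodf_neq0 => i _.
    by rewrite gt_eqF.
  apply: (row_free_inj (n := n) (A := diag_mx v)); first by rewrite row_free_unit.
  rewrite mulVmx// mulmx_diag -scalemx1 scale1r; apply/matrixP => i j.
  by rewrite !mxE mulVf// gt_eqF.
rewrite /mvn_pdf iE det_diag.
have -> : ((row_of_tuple t - theta) *m diag_mx (\row_i (v 0 i)^-1) *m
    (row_of_tuple t - theta)^T) 0 0 =
    \sum_(i < n) (tnth t i - theta 0 i) ^+ 2 / v 0 i.
  rewrite mxE; apply: eq_bigr => i _; rewrite !mxE (bigD1 i)//= big1 => [|j ji].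
    by rewrite addr0 !mxE eqxx mulr1n expr2; ring.
  by rewrite !mxE (negbTE ji) mulr0n mulr0.
have -> : (2 * pi) ^+ n * \prod_i v 0 i = \prod_(i < n) (2 * pi * v 0 i).
  by rewrite big_split/= prodr_const card_ord.
have -> : Num.sqrt (\prod_(i < n) (2 * pi * v 0 i)) =
    \prod_(i < n) Num.sqrt (2 * pi * v 0 i).
  have sM (s : seq 'I_n) : Num.sqrt (\prod_(i <- s) (2 * pi * v 0 i)) =
      \prod_(i <- s) Num.sqrt (2 * pi * v 0 i).
    elim: s => [|i s IHs]; first by rewrite !big_nil sqrtr1.
    by rewrite !big_cons sqrtrM ?IHs// !mulr_ge0 ?pi_ge0// ltW.
  exact: sM.
rewrite -prodfV -sumrN mulr_suml expR_sum -big_split/=.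
apply: eq_bigr => i _; rewrite normal_pdfE ?gt_eqF ?sqrtr_gt0//.
rewrite /normal_peak /normal_fun sqr_sqrtr ?ltW//.
congr (_^-1 * expR _); first by congr Num.sqrt; rewrite -mulr_natl; ring.
by field; rewrite gt_eqF.
Qed.

(** * The one-factor Gaussian model *)

(** The correlation matrix of (Z, b_0 Z + s_0 e_0, ..., b_(n-1) Z + s_(n-1) e_(n-1))
    for independent standard normal Z, e_i and s_i^2 = 1 - b_i^2.  The factor
    itself is the coordinate 0, so that conditioning on it is the block
    decomposition of the matrix. *)
Definition factor_cov (R : realType) n (b : nat -> R) : 'M[R]_(1 + n) :=
  let v : 'rV[R]_n := \row_i b i in
  block_mx 1%:M v v^T (v^T *m v + diag_mx (\row_i (1 - b i ^+ 2))).

Definition factor_mean (R : realType) n (th : nat -> R) : 'rV[R]_(1 + n) :=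
  row_mx 0 (\row_i th i).

(** The quadratic form at (w, x) is (w + sum b_i x_i)^2 + sum (1 - b_i^2) x_i^2. *)
Lemma factor_cov_corrmx (R : realType) n (b : nat -> R) :
  (forall i, b i ^+ 2 < 1) -> corrmx (factor_cov n b).
Proof.
move=> b1; split; last first.
  move=> i; rewrite -(splitK i); case: (fintype.split i) => j /=.
    by rewrite block_mxEul mxE eqxx.
  by rewrite block_mxEdr !mxE eqxx mulr1n big_ord1 !mxE; ring.
split.
  rewrite /factor_cov tr_block_mx trmx1 trmxK; congr block_mx.
  by rewrite linearD /= trmx_mul trmxK tr_diag_mx.
move=> v; rewrite -[v]hsubmxK; set w := lsubmx v; set x := rsubmx v => vn0.
set u : 'rV[R]_n := \row_i b i.
pose s := w + x *m u^T.
have -> : row_mx w x *m factor_cov n b *m (row_mx w x)^T =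
    s *m s^T + x *m diag_mx (\row_i (1 - b i ^+ 2)) *m x^T.
  rewrite /factor_cov -/u mul_row_block tr_row_mx mul_row_col mulmx1.
  have -> : s^T = w^T + u *m x^T by rewrite /s [LHS]raddfD /= trmx_mul trmxK.
  by rewrite /s !mulmxDr !mulmxDl !mulmxA !addrA.
have -> : (s *m s^T + x *m diag_mx (\row_i (1 - b i ^+ 2)) *m x^T) 0 0 =
    s 0 0 ^+ 2 + \sum_i x 0 i ^+ 2 * (1 - b i ^+ 2).
  rewrite mxE; congr (_ + _); first by rewrite mxE big_ord1 !mxE expr2.
  rewrite mxE; apply: eq_bigr => i _; rewrite !mxE (bigD1 i)//= big1 => [|j ji].
    by rewrite addr0 !mxE eqxx mulr1n expr2; ring.
  by rewrite !mxE (negbTE ji) mulr0n mulr0.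
have t0 i : 0 <= x 0 i ^+ 2 * (1 - b i ^+ 2).
  by rewrite mulr_ge0 ?sqr_ge0// subr_ge0 ltW.
have [x0|xn0] := eqVneq x 0.
  rewrite big1 => [|i _]; last by rewrite x0 mxE expr0n mul0r.
  have s0 : s 0 0 != 0.
    apply: contra_neq vn0 => s00; rewrite x0.
    have -> : w = 0.
      apply/rowP => i; rewrite [RHS]mxE -s00 /s x0 mul0mx addr0.
      by congr (w _ _); rewrite ord1.
    by apply/rowP => i; rewrite !mxE; case: fintype.split => j; rewrite mxE.
  by rewrite addr0 exprn_even_gt0.
have /rV0Pn[i xi] : x != 0 by [].
rewrite ltr_wpDl ?sqr_ge0// (bigD1 i)//= ltr_pwDl ?sumr_ge0//.
by rewrite mulr_gt0 ?subr_gt0// exprn_even_gt0.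
Qed.

Lemma measurable_FDP_two_sided (R : realType) (q : R) N (theta : 'rV[R]_N) :
  0 <= q -> measurable_fun setT
    (fun t : N.-tuple (measurableTypeR R) => FDP q theta (two_sided_pvalues t)).
Proof.
move=> q0; apply: measurable_FDP => // i.
apply: (measurableT_comp measurable_pvalue).
by apply: measurableT_comp => //; exact: measurable_tnth.
Qed.

Lemma FDP_ge0 (R : realType) (q : R) N (theta : 'rV[R]_N) P : 0 <= FDP q theta P.
Proof. by rewrite divr_ge0. Qed.

(** The joint density of the coordinates other than the factor, given that the
    factor is z. *)
Definition cond_density (R : realType) n (th b : nat -> R) (z : R)
    (t : n.-tuple (measurableTypeR R)) : R :=
  \prod_(i < n) normal_pdf (th i + b i * z) (Num.sqrt (1 - b i ^+ 2)) (tnth t i).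

(** Splitting off the coordinate 0 leaves a normal law whose covariance is the
    Schur complement, here diagonal; this is the conditional independence. *)
Lemma FDR_factor_model (R : realType) (q : R) n (th b : nat -> R) :
  0 <= q -> (forall i, b i ^+ 2 < 1) ->
  let theta := factor_mean n th in
  (FDR q theta (factor_cov n b) =
   \int[lebesgue_measure]_z \int[lebesgue_tuple R n]_t
     (FDP q theta (two_sided_pvalues (tuple_cons (z, t) : (1 + n).-tuple _)) *
      cond_density th b z t * phi z)%:E)%E.
Proof.
move=> q0 b1 theta; set S := factor_cov n b.
have mF := measurable_FDP_two_sided theta q0.
have mp := measurable_mvn_pdf theta S.
have p0 := mvn_pdf_ge0 theta S.
rewrite /FDR (@ge0_integral_density _ _ _ (lebesgue_tuple R (1 + n)) _ (mvn_pdf theta S))//;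
  last 2 first.
- exact/measurable_EFinP.
- by move=> t; rewrite lee_fin FDP_ge0.
rewrite ge0_integral_lebesgue_tupleS; last 2 first.
- by apply: emeasurable_funM; exact/measurable_EFinP.
- by move=> t; rewrite mule_ge0 ?lee_fin ?FDP_ge0.
apply: eq_integral => z _; apply: eq_integral => t _.
rewrite -EFinM; congr (_%:E).
rewrite (mvn_pdf_cons _ _ _ (proj1 (factor_cov_corrmx n b1))).
have thE : theta 0 0 = 0.
  by rewrite mxE; case: splitP => // j _; rewrite mxE.
have SE : S 0 0 = 1.
  by have [_ ->] := factor_cov_corrmx n b1.
rewrite -/S thE SE subr0 invr1 mulr1 scale1r sqrtr1.
have -> : ursubmx S = \row_i b i by rewrite block_mxKur.
have -> : drsubmx S - (\row_i b i)^T *m (\row_i b i) = diag_mx (\row_i (1 - b i ^+ 2)).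
  by rewrite block_mxKdr addrC addKr.
rewrite mvn_pdf_diag => [|i]; last by rewrite mxE subr_gt0.
rewrite -mulrA; congr (_ * _); rewrite mulrC; congr (_ * _).
by apply: eq_bigr => i _; rewrite row_mxKr !mxE [z * _]mulrC.
Qed.

Lemma measurable_cond_density (R : realType) n (th b : nat -> R) :
  (forall i, b i ^+ 2 < 1) ->
  measurable_fun setT (fun p : measurableTypeR R * n.-tuple (measurableTypeR R) =>
    cond_density th b p.1 p.2).
Proof.
move=> b1; apply: measurable_prod => i _.
have s0 : Num.sqrt (1 - b i ^+ 2) != 0 by rewrite gt_eqF// sqrtr_gt0 subr_gt0.
have pE m (x : R) : normal_pdf m (Num.sqrt (1 - b i ^+ 2)) x =
    normal_pdf 0 (Num.sqrt (1 - b i ^+ 2)) (x - m).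
  by rewrite !normal_pdfE// normal_fun_center.
under eq_fun do rewrite pE.
apply: (measurableT_comp (measurable_normal_pdf _ _)).
apply: measurable_funB.
  by apply: (measurableT_comp (measurable_tnth i)).
apply: measurable_funD => //; apply: measurable_funM => //.
Qed.

Lemma cond_density_ge0 (R : realType) n (th b : nat -> R) z
    (t : n.-tuple (measurableTypeR R)) : 0 <= cond_density th b z t.
Proof. by apply: prodr_ge0 => i _; exact: normal_pdf_ge0. Qed.

(** A bound of the conditional expectation by a function h of the factor is
    integrated over the factor; Tonelli supplies the measurability. *)
Lemma FDR_factor_model_ge (R : realType) (q : R) n (th b : nat -> R)
    (h : measurableTypeR R -> R) :
  0 <= q -> (forall i, b i ^+ 2 < 1) ->
  let theta := factor_mean n th in
  measurable_fun setT h -> (forall z, 0 <= h z) ->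
  (forall z, (h z)%:E <= \int[lebesgue_tuple R n]_t
     (FDP q theta (two_sided_pvalues (tuple_cons (z, t) : (1 + n).-tuple _)) *
      cond_density th b z t)%:E)%E ->
  (\int[lebesgue_measure]_z (h z * phi z)%:E <= FDR q theta (factor_cov n b))%E.
Proof.
move=> q0 b1 theta mh h0 hle; rewrite FDR_factor_model//.
have mphi : measurable_fun [set: measurableTypeR R] (@phi R).
  exact: measurable_normal_pdf.
have mcd := @measurable_cond_density R n th b b1.
have mF : measurable_fun setT
    (fun p : measurableTypeR R * n.-tuple (measurableTypeR R) =>
      FDP q theta (two_sided_pvalues (tuple_cons p : (1 + n).-tuple _))).
  apply: (measurableT_comp (measurable_FDP_two_sided theta q0)).
  exact: measurable_tuple_cons.
pose H (p : measurableTypeR R * n.-tuple (measurableTypeR R)) : R :=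
  FDP q theta (two_sided_pvalues (tuple_cons p : (1 + n).-tuple _)) *
  cond_density th b p.1 p.2.
have mH : measurable_fun setT H by exact: measurable_funM.
have H0 p : 0 <= H p by rewrite mulr_ge0 ?FDP_ge0 ?cond_density_ge0.
have key (G : measurableTypeR R * n.-tuple (measurableTypeR R) -> \bar R) :
    measurable_fun setT G -> (forall p, 0 <= G p)%E ->
    measurable_fun [set: measurableTypeR R]
      (fun z => \int[lebesgue_tuple R n]_t G (z, t))%E.
  by move=> mG G0; exact: measurable_fun_fubini_tonelli_F.
apply: ge0_le_integral => //.
- by move=> z _; rewrite lee_fin mulr_ge0// normal_pdf_ge0.
- by apply/measurable_EFinP; exact: measurable_funM.
- apply: (key (fun p => (H p * phi p.1)%:E)).
  + apply/measurable_EFinP; apply: measurable_funM; first exact: mH.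
    exact: (measurableT_comp mphi).
  + by move=> p; rewrite lee_fin mulr_ge0 ?H0 ?normal_pdf_ge0.
move=> z _; under eq_integral do rewrite EFinM.
rewrite ge0_integralZr//.
- by rewrite EFinM lee_wpmul2r// lee_fin normal_pdf_ge0.
- apply/measurable_EFinP; apply: (measurableT_comp mH); exact: measurable_pair1.
- by move=> t _; rewrite lee_fin; exact: (H0 (z, t)).
- by rewrite lee_fin normal_pdf_ge0.
Qed.

(** * Probability of the good event under a product density *)

(** A union bound: if F >= v up to an error dominated by products of functions
    of single coordinates, the expectation of F is at least v minus the
    expectations of these products, which are computed by independence. *)
Lemma integral_prod_density_ge (R : realType) n K (f : nat -> measurableTypeR R -> R)
    (C : 'I_K -> R) (w : 'I_K -> nat -> measurableTypeR R -> R)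
    (e : 'I_K -> nat -> R) (F : n.-tuple (measurableTypeR R) -> R) (v : R) :
  (forall i, measurable_fun setT (f i)) -> (forall i x, 0 <= f i x) ->
  (forall i, \int[lebesgue_measure]_x (f i x)%:E = 1)%E ->
  (forall s, 0 <= C s) ->
  (forall s i, measurable_fun setT (w s i)) -> (forall s i x, 0 <= w s i x) ->
  (forall s i, (i < n)%N ->
    \int[lebesgue_measure]_x (w s i x * f i x)%:E = (e s i)%:E)%E ->
  measurable_fun setT F -> (forall t, 0 <= F t) -> 0 <= v ->
  (forall t, v <= F t + \sum_s C s * \prod_(i < n) w s i (tnth t i)) ->
  ((v - \sum_s C s * \prod_(i < n) e s i)%:E <=
   \int[lebesgue_tuple R n]_t (F t * \prod_(i < n) f i (tnth t i))%:E)%E.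
Proof.
move=> mf f0 f1 C0 mw w0 we mF F0 v0 vF.
have mp (g : nat -> measurableTypeR R -> R) : (forall i, measurable_fun setT (g i)) ->
    measurable_fun setT (fun t : n.-tuple (measurableTypeR R) =>
      \prod_(i < n) g i (tnth t i)).
  move=> mg; apply: measurable_prod => i _.
  by apply: (measurableT_comp (mg i)); exact: measurable_tnth.
pose D (t : n.-tuple (measurableTypeR R)) := \prod_(i < n) f i (tnth t i).
have mD : measurable_fun setT D by exact: mp.
have D0 t : 0 <= D t by exact: prodr_ge0.
have D1 : (\int[lebesgue_tuple R n]_t (D t)%:E = 1)%E.
  by rewrite (integral_tuple_prod (c := fun=> 1))// big1.
have iW s : (\int[lebesgue_tuple R n]_t
    (C s * \prod_(i < n) (w s i (tnth t i) * f i (tnth t i)))%:E =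
    (C s * \prod_(i < n) e s i)%:E)%E.
  have mwf i : measurable_fun setT (fun x => w s i x * f i x) by exact: measurable_funM.
  under eq_integral do rewrite EFinM.
  rewrite ge0_integralZl//; last 3 first.
  - by apply/measurable_EFinP; exact: mp mwf.
  - by move=> t _; rewrite lee_fin prodr_ge0// => i _; rewrite mulr_ge0.
  - by rewrite lee_fin.
  rewrite (integral_tuple_prod (g := fun i x => w s i x * f i x) (c := e s))//; last 2 first.
  - by move=> i x; rewrite mulr_ge0.
  - by move=> i ?; exact: we.
rewrite EFinB leeBlDr//.
have -> : (\sum_s C s * \prod_(i < n) e s i)%:E = (\int[lebesgue_tuple R n]_t
    (\sum_s (C s * \prod_(i < n) (w s i (tnth t i) * f i (tnth t i)))%:E))%E.
  rewrite ge0_integral_sum//; last 2 first.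
  - move=> s; apply/measurable_EFinP; apply: measurable_funM => //.
    by apply: (mp (fun i x => w s i x * f i x)) => i; exact: measurable_funM.
  - move=> s t _; rewrite lee_fin mulr_ge0// prodr_ge0// => i _.
    by rewrite mulr_ge0.
  by rewrite -sumEFin; apply: eq_bigr => s _; rewrite iW.
rewrite -ge0_integralD//; last 4 first.
- by move=> t _; rewrite lee_fin mulr_ge0//; exact: D0.
- by apply/measurable_EFinP; exact: measurable_funM.
- move=> t _; apply: sume_ge0 => s _; rewrite lee_fin mulr_ge0// prodr_ge0// => i _.
  by rewrite mulr_ge0.
- apply: emeasurable_sum => s; apply/measurable_EFinP; apply: measurable_funM => //.
  by apply: (mp (fun i x => w s i x * f i x)) => i; exact: measurable_funM.
have -> : v%:E = (\int[lebesgue_tuple R n]_t (v * D t)%:E)%E.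
  under eq_integral do rewrite EFinM.
  rewrite ge0_integralZl ?D1 ?mule1//; first exact/measurable_EFinP.
  by move=> t _; rewrite lee_fin.
apply: ge0_le_integral => //.
- by move=> t _; rewrite lee_fin mulr_ge0.
- by apply/measurable_EFinP; exact: measurable_funM.
- apply: emeasurable_funD; first by apply/measurable_EFinP; exact: measurable_funM.
  apply: emeasurable_sum => s; apply/measurable_EFinP; apply: measurable_funM => //.
  by apply: (mp (fun i x => w s i x * f i x)) => i; exact: measurable_funM.
move=> t _; rewrite sumEFin -EFinD lee_fin.
rewrite [leRHS](_ : _ = (F t + \sum_s C s * \prod_(i < n) w s i (tnth t i)) * D t).
  by rewrite ler_wpM2r.
rewrite mulrDl mulr_suml; congr (_ + _); apply: eq_bigr => s _.
by rewrite big_split/= mulrA.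
Qed.

(** The good event asks that at least c of the coordinates i >= J fall in A and
    that no coordinate i < J falls in B_i.  The first part fails with
    probability at most the Chernoff product, since the indicator of a count
    below c is at most e^(lam c) times the product of the e^(-lam 1_A(t_i)); the
    second fails with probability at most the sum of the pB_i. *)
Lemma integral_density_good_event_ge (R : realType) n J
    (f : nat -> measurableTypeR R -> R) (A : set (measurableTypeR R))
    (B : nat -> set (measurableTypeR R)) (pA pB : nat -> R)
    (F : n.-tuple (measurableTypeR R) -> R) (c lam v : R) :
  (J <= n)%N ->
  (forall i, measurable_fun setT (f i)) -> (forall i x, 0 <= f i x) ->
  (forall i, \int[lebesgue_measure]_x (f i x)%:E = 1)%E ->
  measurable A -> (forall i, measurable (B i)) ->
  (forall i, \int[lebesgue_measure]_(x in A) (f i x)%:E = (pA i)%:E)%E ->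
  (forall i, \int[lebesgue_measure]_(x in B i) (f i x)%:E = (pB i)%:E)%E ->
  0 <= lam -> measurable_fun setT F -> (forall t, 0 <= F t) -> 0 <= v <= 1 ->
  (forall t, c <= \sum_(i < n | (J <= i)%N) \1_A (tnth t i) ->
     (forall i : 'I_n, (i < J)%N -> ~ B i (tnth t i)) -> v <= F t) ->
  ((v - (expR (lam * c) * \prod_(i < n | (J <= i)%N) (1 - (1 - expR (- lam)) * pA i)
         + \sum_(i < J) pB i))%:E <=
   \int[lebesgue_tuple R n]_t (F t * \prod_(i < n) f i (tnth t i))%:E)%E.
Proof.
move=> Jn mf f0 f1 mA mB fA fB lam0 mF F0 /andP[v0 v1] vF.
have el1 : expR (- lam) <= 1 by rewrite -expR0 ler_expR oppr_le0.
(* The index 0 carries the Chernoff product, the index j + 1 the event B_j. *)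
pose C (s : 'I_J.+1) : R := if s == ord0 then expR (lam * c) else 1.
pose w (s : 'I_J.+1) i (x : measurableTypeR R) : R :=
  if s == ord0 then (if (i < J)%N then 1 else 1 - (1 - expR (- lam)) * \1_A x)
  else (if i == s.-1 then \1_(B i) x else 1).
pose e (s : 'I_J.+1) i : R :=
  if s == ord0 then (if (i < J)%N then 1 else 1 - (1 - expR (- lam)) * pA i)
  else (if i == s.-1 then pB i else 1).
have mfe i : measurable_fun setT (EFin \o f i) by exact/measurable_EFinP.
have ind (E : set (measurableTypeR R)) i (p : R) : measurable E ->
    (\int[lebesgue_measure]_(x in E) (f i x)%:E = p%:E)%E ->
    (\int[lebesgue_measure]_x (\1_E x * f i x)%:E = p%:E)%E.
  move=> mE <-; rewrite [RHS]integral_mkcond; apply: eq_integral => x _.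
  by rewrite patchE indicE; case: (x \in E); rewrite ?mul1r ?mul0r.
have w0 s i x : 0 <= w s i x.
  rewrite /w; case: ifP => _; case: ifP => _ //.
have mw s i : measurable_fun setT (w s i).
  rewrite /w; have [_|_] := eqVneq s ord0; last first.
    by have [_|_] := eqVneq i s.-1 => //; exact: measurable_indic.
  have [_|_] := ltnP i J => //.
  by apply: measurable_funB => //; apply: measurable_funM => //; exact: measurable_indic.
have we s i : (i < n)%N ->
    (\int[lebesgue_measure]_x (w s i x * f i x)%:E = (e s i)%:E)%E.
  move=> _; rewrite /w /e; have [_|s0] := eqVneq s ord0; last first.
    have [_|_] := eqVneq i s.-1; first exact: ind.
    by under eq_integral do rewrite mul1r; exact: f1.
  have [_|_] := ltnP i J; first by under eq_integral do rewrite mul1r; exact: f1.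
  set I := integral _ _ _.
  have : (I + (1 - expR (- lam))%:E * \int[lebesgue_measure]_x (\1_A x * f i x)%:E = 1)%E.
    rewrite -ge0_integralZl//; last 3 first.
    - apply/measurable_EFinP; apply: measurable_funM => //; exact: measurable_indic.
    - by move=> x _; rewrite lee_fin mulr_ge0.
    - by rewrite lee_fin subr_ge0.
    rewrite /I -ge0_integralD//; last 4 first.
    - move=> x _; rewrite lee_fin mulr_ge0//.
    - apply/measurable_EFinP; apply: measurable_funM => //.
      apply: measurable_funB => //; apply: measurable_funM => //.
    - by move=> x _; rewrite -EFinM lee_fin; apply: mulr_ge0; rewrite ?subr_ge0// mulr_ge0.
    - apply: emeasurable_funM => //; apply/measurable_EFinP.
      by apply: measurable_funM => //; exact: measurable_indic.
    rewrite -(f1 i); apply: eq_integral => x _.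
    by rewrite -EFinM -EFinD; congr (_%:E); ring.
  rewrite (ind _ _ _ mA (fA i)) -EFinM => IE.
  rewrite EFinB -IE addeK//.
have C0 s : 0 <= C s by rewrite /C; case: ifP => _ //; exact: expR_ge0.
have := integral_prod_density_ge mf f0 f1 C0 mw w0 we mF F0 v0.
have -> : \sum_s C s * \prod_(i < n) e s i =
    expR (lam * c) * \prod_(i < n | (J <= i)%N) (1 - (1 - expR (- lam)) * pA i)
         + \sum_(i < J) pB i.
  rewrite big_ord_recl /C /e eqxx; congr (_ * _ + _).
    by rewrite [RHS]big_mkcond; apply: eq_bigr => i _; rewrite (leqNgt J i); case: (i < J)%N.
  apply: eq_bigr => j _; rewrite (_ : (lift _ _ == _) = false)// mul1r.
  have jn : (j < n)%N by rewrite (leq_trans _ Jn).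
  rewrite (bigD1 (Ordinal jn))//= eqxx big1 ?mulr1// => i ij.
  by rewrite (_ : (_ == _) = false)//; apply: contraNF ij => /eqP ij; apply/eqP/val_inj.
apply; move=> t.
have S0 s : 0 <= C s * \prod_(i < n) w s i (tnth t i).
  by rewrite mulr_ge0// prodr_ge0.
have [cnt|cnt] := lerP c (\sum_(i < n | (J <= i)%N) \1_A (tnth t i)); last first.
  rewrite ler_wpDl// (bigD1 ord0)//= ler_wpDr ?sumr_ge0// (le_trans v1)//.
  have -> : \prod_(i < n) w ord0 i (tnth t i) =
      expR (- lam * \sum_(i < n | (J <= i)%N) \1_A (tnth t i)).
    rewrite mulr_sumr expR_sum [RHS]big_mkcond; apply: eq_bigr => i _.
    rewrite /w eqxx (leqNgt J i); case: (i < J)%N => //=.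
    rewrite indicE; case: (_ \in A); rewrite ?mulr1 ?mulr0 ?expR0; ring.
  rewrite /C eqxx -expRD -expR0 ler_expR mulNr -mulrBr.
  by rewrite mulr_ge0// subr_ge0 ltW.
have [/existsP[i /andP[iJ /asboolP iB]]|/existsPn nB] :=
    boolP [exists i : 'I_n, (i < J)%N && `[< B i (tnth t i) >]]; last first.
  rewrite ler_wpDr ?sumr_ge0// vF// => i iJ /asboolP iB.
  by have := nB i; rewrite iJ iB.
rewrite ler_wpDl// (bigD1 (lift ord0 (Ordinal iJ)))//= ler_wpDr ?sumr_ge0//.
rewrite (le_trans v1)// /C /w (_ : (lift _ _ == _) = false)// mul1r.
rewrite big1// => k _; have [ki|//] := eqVneq (k : nat) (lift ord0 (Ordinal iJ)).-1.
rewrite (_ : k = i); last exact/val_inj.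
by rewrite indicE mem_set.
Qed.

(** * A lower bound for the false discovery proportion *)

(** Order statistics are only ever used through this counting criterion. *)
Lemma order_stat_le_card (R : realType) N (P : 'I_N -> R) (c : R) k :
  (0 < k <= N)%N ->
  (order_stat P k <= c) = (k <= #|[set i | (P i <= c)%R]%SET|)%N.
Proof.
case: k => // k /andP[_ kN].
have ss : sorted <=%R (sort <=%R (codom P)) by exact: sort_le_sorted.
have cE : #|[set i | (P i <= c)%R]%SET| = count (<= c) (sort <=%R (codom P)).
  rewrite count_sort count_map cardE [in LHS]/enum_mem -enumT size_filter.
  by apply: eq_count => i; rewrite /= inE.
rewrite cE /order_stat /=; have [kc|kc] := ltnP; first exact: nth_count_le.
by apply/negbTE; rewrite -ltNge nth_count_gt// kc size_sort size_codom card_ord.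
Qed.

(** If the empirical distribution function of the p-values reaches t / q at t,
    the procedure rejects at least as many hypotheses as there are p-values below
    t.  Its actual number of rejections m is unknown, which is why the bound on
    the alternatives is required at every level q m / N that it may use. *)
Lemma FDP_ge (R : realType) (q : R) N (theta : 'rV[R]_N) (P : 'I_N -> R) (t be : R) :
  0 < q -> let below c := [set i | P i <= c]%SET in
  (0 < #|below t|)%N -> N%:R * t / q <= #|below t|%:R ->
  (forall m : nat, (#|below t| <= m)%N ->
     #|[set i in below (q * m%:R / N%:R) | theta 0 i != 0%R]%SET|%:R <= be * m%:R) ->
  1 - be <= FDP q theta P.
Proof.
move=> q0 below c0 ct alt.
have cN : (#|below t| <= N)%N by rewrite -[leqRHS]card_ord max_card.
have N0 : 0 < N%:R :> R by rewrite ltr0n (leq_trans c0).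
set Q := fun k : 'I_N.+1 => (0 < k)%N && (order_stat P k <= q * k%:R / N%:R).
pose c : 'I_N.+1 := Ordinal (cN : (#|below t| < N.+1)%N).
have Qc : Q c.
  rewrite /Q c0/= (@le_trans _ _ t) ?order_stat_le_card ?c0//.
  by rewrite ler_pdivlMr// mulrC [q * _]mulrC -ler_pdivrMr.
have cR : (#|below t| <= BH_num q P)%N
  by exact: (@leq_bigmax_cond _ Q (fun k : 'I_N.+1 => k : nat) c Qc).
have [k Qk kE] : {k | Q k & BH_num q P = k}.
  by apply: (@eq_bigmax_cond _ Q (fun k : 'I_N.+1 => k : nat)); apply/card_gt0P; exists c.
have k0 : (0 < k)%N by rewrite -kE (leq_trans c0).
move: Qk => /andP[_ Pk].
have kN : (k <= N)%N by rewrite -ltnS.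
rewrite /FDP kE (maxn_idPl k0) ler_pdivlMr ?ltr0n//.
set S := BH_rejected q P.
have SE : S = below (order_stat P k).
  by apply/setP => i; rewrite !inE kE k0.
have kS : (k <= #|S|)%N by rewrite SE -order_stat_le_card ?k0.
have -> : #|[set i in S | theta 0 i == 0%R]%SET|%:R =
    #|S|%:R - #|[set i in S | theta 0 i != 0%R]%SET|%:R :> R.
  apply/eqP; rewrite -subr_eq opprK -natrD; apply/eqP; congr (_%:R).
  rewrite -(cardsID [set i | theta 0 i == 0%R]%SET S); congr (_ + _)%N; apply: eq_card => i.
    by rewrite !inE.
  by rewrite !inE andbC.
rewrite mulrBl mul1r lerB ?ler_nat//.
rewrite (le_trans _ (alt k _)) ?ler_nat -?kE//.
apply: subset_leq_card; apply/fintype.subsetP => i; rewrite SE !inE => /andP[iS ->].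
by rewrite andbT kE (le_trans iS).
Qed.

(** * The hyperbolic cosine and normal probabilities *)

Lemma coshN (R : realType) (x : R) : cosh (- x) = cosh x.
Proof. by rewrite /cosh opprK addrC. Qed.

Lemma cosh_norm (R : realType) (x : R) : cosh `|x| = cosh x.
Proof. by case: (ler0P x) => _ //; exact: coshN. Qed.

Lemma cosh_gt0 (R : realType) (x : R) : 0 < cosh x.
Proof. by rewrite divr_gt0// addr_gt0 ?expR_gt0. Qed.

(** This factorization carries both the weak and the strict monotonicity. *)
Lemma coshB (R : realType) (x y : R) :
  cosh y - cosh x = (expR y - expR x) * (1 - expR (- x - y)) / 2.
Proof.
rewrite expRD /cosh; have := expRxMexpNx_1 x; have := expRxMexpNx_1 y.
move: (expR x) (expR (- x)) (expR y) (expR (- y)) => a b c d cd ab.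
have -> : (c - a) * (1 - b * d) = c - a - c * d * b + a * b * d by ring.
by rewrite cd ab; field.
Qed.

Lemma lt_cosh (R : realType) (x y : R) : 0 <= x -> x < y -> cosh x < cosh y.
Proof.
move=> x0 xy; rewrite -subr_gt0 coshB divr_gt0// mulr_gt0// subr_gt0 ?ltr_expR//.
by rewrite -expR0 ltr_expR; lra.
Qed.

Lemma le_cosh (R : realType) (x y : R) : `|x| <= `|y| -> cosh x <= cosh y.
Proof.
rewrite le_eqVlt -(cosh_norm x) -(cosh_norm y) => /predU1P[->//|xy].
by rewrite ltW// lt_cosh.
Qed.

Lemma cosh_ge1 (R : realType) (x : R) : 1 <= cosh x.
Proof.
have -> : 1 = cosh 0 :> R by rewrite /cosh oppr0 expR0; lra.
by apply: le_cosh; rewrite normr0.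
Qed.

Lemma normal_prob_fin (R : realType) (m s : R) A : measurable A ->
  (fine (normal_prob m s A))%:E = normal_prob m s A.
Proof. by move=> mA; rewrite fineK// fin_num_measure. Qed.

(** All tail estimates below compare two normal densities pointwise, which
    avoids changes of variables. *)
Lemma normal_prob_le (R : realType) (m s m' s' c : R) (A : set (measurableTypeR R)) :
  measurable A -> 0 <= c ->
  (forall x, A x -> normal_pdf m s x <= c * normal_pdf m' s' x) ->
  fine (normal_prob m s A) <= c * fine (normal_prob m' s' A).
Proof.
move=> mA c0 h; rewrite -lee_fin EFinM !normal_prob_fin//.
have mn a b : measurable_fun A (fun x => (normal_pdf a b x)%:E).
  by apply/measurable_funTS/measurable_EFinP; exact: measurable_normal_pdf.
rewrite -ge0_integralZl//; last first.
  by move=> x _; rewrite lee_fin normal_pdf_ge0.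
apply: ge0_le_integral => //.
- by move=> x _; rewrite lee_fin normal_pdf_ge0.
- exact: measurable_funeM.
Qed.

Lemma normal_prob_ge0 (R : realType) (m s : R) A : 0 <= fine (normal_prob m s A).
Proof. by apply: fine_ge0; exact: measure_ge0. Qed.

Lemma normal_prob_le1 (R : realType) (m s : R) (A : set (measurableTypeR R)) :
  measurable A -> fine (normal_prob m s A) <= 1.
Proof. by move=> mA; rewrite -lee_fin normal_prob_fin//; exact: probability_le1. Qed.

Lemma normal_prob_subset (R : realType) (m s : R) (A B : set (measurableTypeR R)) :
  measurable A -> measurable B -> A `<=` B ->
  fine (normal_prob m s A) <= fine (normal_prob m s B).
Proof.
by move=> mA mB AB; rewrite -lee_fin !normal_prob_fin//; apply: le_measure; rewrite ?inE.
Qed.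

Lemma normal_probU (R : realType) (m s : R) (A B : set (measurableTypeR R)) :
  measurable A -> measurable B -> A `&` B = set0 ->
  fine (normal_prob m s (A `|` B)) = fine (normal_prob m s A) + fine (normal_prob m s B).
Proof.
move=> mA mB AB; apply: EFin_inj; rewrite EFinD !normal_prob_fin//; last exact: measurableU.
exact: measureU.
Qed.

Lemma normal_probU_le (R : realType) (m s : R) (A B : set (measurableTypeR R)) :
  measurable A -> measurable B ->
  fine (normal_prob m s (A `|` B)) <= fine (normal_prob m s A) + fine (normal_prob m s B).
Proof.
move=> mA mB; rewrite -lee_fin EFinD !normal_prob_fin//; last exact: measurableU.
exact: measureU2.
Qed.

(** * Tails of the standard normal distribution *)

Lemma pvalueE (R : realType) (x : R) :
  pvalue x = 2 * fine (normal_prob 0 1 `]x, +oo[%classic).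
Proof.
rewrite /pvalue /Phi; congr (2 * _).
have := @normal_probU R 0 1 `]-oo, x]%classic `]x, +oo[%classic
  (measurable_itv _) (measurable_itv _).
rewrite -itv_bndbnd_setU ?bnd_simp// set_itvNyy => UE.
have P1 : fine (normal_prob 0 1 [set: R]) = 1 by rewrite probability_setT.
apply/eqP; rewrite -P1 subr_eq P1 addrC -UE ?P1//.
by rewrite -subset0 => y /= []; rewrite !in_itv/= andbT => yx /(le_lt_trans yx); rewrite ltxx.
Qed.

Lemma le_pvalue (R : realType) (x y : R) : x <= y -> pvalue y <= pvalue x.
Proof.
move=> xy; rewrite !pvalueE ler_pM2l// normal_prob_subset//.
by apply: subset_itvr; rewrite bnd_simp.
Qed.

(** On [x, +oo[ the standard normal density is at most e^(-x^2/2) times the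
    density of N(x, 1). *)
Lemma pvalue_le (R : realType) (x : R) : 0 <= x -> pvalue x <= 2 * expR (- x ^+ 2 / 2).
Proof.
move=> x0; rewrite pvalueE ler_pM2l//.
rewrite (le_trans (@normal_prob_le R 0 1 x 1 (expR (- x ^+ 2 / 2)) _ _ _ _))//.
  move=> v /=; rewrite in_itv/= andbT => xv.
  rewrite !normal_pdfE ?oner_neq0// mulrCA /normal_fun ler_wpM2l//.
    by rewrite normal_peak_ge0.
  by rewrite -expRD ler_expR expr1n subr0; nra.
by rewrite ler_piMr// normal_prob_le1.
Qed.

Lemma normal_pdf_sd1_le1 (R : realType) (m x : R) : normal_pdf m 1 x <= 1.
Proof.
rewrite (le_trans (normal_pdf_ub _ _ _)) ?oner_neq0//.
have p1 : 1 <= pi *+ 2 :> R by have := @pi_ge2 R; rewrite mulr2n; lra.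
rewrite /normal_peak expr1n mul1r invf_le1 ?sqrtr_gt0 ?(lt_le_trans _ p1)//.
by rewrite -[leLHS]sqrtr1 ler_wsqrtr.
Qed.

Lemma normal_prob_itv_le (R : realType) (a b : R) : a <= b ->
  fine (normal_prob 0 1 `[a, b]%classic) <= b - a.
Proof.
move=> ab; rewrite -lee_fin normal_prob_fin//.
have -> : (b - a)%:E = (\int[lebesgue_measure]_(x in `[a, b]) (cst 1%:E) x)%E.
  rewrite integral_cst//= mul1e lebesgue_measure_itv/= lte_fin.
  by case: ltgtP ab => // -> _; rewrite subrr.
apply: ge0_le_integral => //.
- by move=> x _; rewrite lee_fin normal_pdf_ge0.
- by apply/measurable_funTS/measurable_EFinP; exact: measurable_normal_pdf.
- by move=> x _; rewrite lee_fin normal_pdf_sd1_le1.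
Qed.

Lemma normal_prob_itv_ge (R : realType) (a b c : R) : a <= b ->
  (forall x, a <= x <= b -> c <= phi x) -> 0 <= c ->
  c * (b - a) <= fine (normal_prob 0 1 `[a, b]%classic).
Proof.
move=> ab h c0; rewrite -lee_fin normal_prob_fin//.
have -> : (c * (b - a))%:E = (\int[lebesgue_measure]_(x in `[a, b]) (cst c%:E) x)%E.
  rewrite integral_cst//= lebesgue_measure_itv/= lte_fin.
  by case: ltgtP ab => // -> _; rewrite subrr mulr0 mule0.
apply: ge0_le_integral => //.
by apply/measurable_funTS/measurable_EFinP; exact: measurable_normal_pdf.
Qed.

Lemma phiE (R : realType) (x : R) : phi x = normal_peak 1 * expR (- x ^+ 2 / 2).
Proof. by rewrite /phi normal_pdfE ?oner_neq0// /normal_fun subr0 expr1n. Qed.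

Lemma pvalue_ge (R : realType) (x h : R) : 0 <= x -> 0 < h ->
  h * phi (x + h) <= pvalue x.
Proof.
move=> x0 h0; rewrite pvalueE.
have phi0 (y : R) : 0 <= phi y by exact: normal_pdf_ge0.
have := @normal_prob_itv_ge R (x + h / 2) (x + h) (phi (x + h)) _ _ (phi0 _).
have -> : x + h - (x + h / 2) = h / 2 by field.
move=> H; apply: (@le_trans _ _ (2 * fine (normal_prob 0 1 `[x + h / 2, x + h]%classic))).
  rewrite (le_trans _ (ler_wpM2l _ (H _ _)))//; first by rewrite [leRHS](_ : _ = h * phi (x + h))//; field.
    by lra.
  move=> v /andP[v1 v2]; rewrite !phiE ler_wpM2l ?normal_peak_ge0// ler_expR.
  by rewrite ler_pM2r// lerN2; apply: lerXn2r; rewrite ?nnegrE//; lra.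
rewrite ler_pM2l//; apply: normal_prob_subset => // v /=.
by rewrite !in_itv/= andbT => /andP[v1 v2]; lra.
Qed.

Lemma pvalue_gt0 (R : realType) (x : R) : 0 <= x -> 0 < pvalue x.
Proof.
move=> x0; apply: lt_le_trans (pvalue_ge x0 ltr01).
by rewrite mul1r phiE mulr_gt0 ?normal_peak_gt0 ?oner_neq0// expR_gt0.
Qed.

(** The scale separation behind the construction: since
    x^2 - (x - e/2)^2 grows linearly in x, moving the threshold by a fixed e
    changes the p-value by an arbitrarily large factor. *)
Lemma pvalue_shift_small (R : realType) (be e : R) : 0 < be -> 0 < e ->
  exists X : R, forall x, X <= x -> pvalue x <= be * pvalue (x - e).
Proof.
move=> be0 e0; have k0 : 0 < normal_peak 1 :> R by rewrite normal_peak_gt0 ?oner_neq0.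
set k := normal_peak 1 in k0; pose K := be * e * k / 4.
have K0 : 0 < K by rewrite divr_gt0// !mulr_gt0.
(* Compare p(x) <= 2 e^(-x^2/2) with p(x - e) >= (e/2) phi(x - e/2). *)
exists (Num.max e ((e ^+ 2 / 8 - ln K) * 2 / e)) => x; rewrite ge_max => /andP[xe xX].
have x0 : 0 <= x by rewrite (le_trans _ xe)// ltW.
rewrite (le_trans (pvalue_le x0))//.
have e20 : 0 < e / 2 by rewrite divr_gt0.
have xe0 : 0 <= x - e by rewrite subr_ge0.
rewrite (le_trans _ (ler_wpM2l (ltW be0) (pvalue_ge xe0 e20)))//.
have -> : x - e + e / 2 = x - e / 2 by field.
rewrite phiE -/k.
have -> : be * (e / 2 * (k * expR (- (x - e / 2) ^+ 2 / 2))) =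
   2 * (K * expR (- (x - e / 2) ^+ 2 / 2)) by rewrite /K; field.
rewrite ler_pM2l// -[K]lnK ?posrE// -expRD ler_expR.
move: xX; rewrite ler_pdivrMr// => xX; nra.
Qed.

Lemma exists_pvalue_le (R : realType) (be : R) : 0 < be ->
  exists X : R, forall x, X <= x -> pvalue x <= be.
Proof.
move=> be0; exists (Num.max 0 (2 * (1 - ln (be / 2)))) => x; rewrite ge_max => /andP[x0 xX].
rewrite (le_trans (pvalue_le x0))//.
have be20 : 0 < be / 2 by rewrite divr_gt0.
have -> : be = 2 * expR (ln (be / 2)) by rewrite lnK ?posrE//; field.
rewrite ler_pM2l// ler_expR; nra.
Qed.

(** * Conditional laws of the statistics given the factor *)

Lemma measurable_norm_ge (R : realType) (x : R) :
  measurable ([set y | x <= `|y|] : set (measurableTypeR R)).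
Proof.
have -> : [set y : R | x <= `|y|] = `[x, +oo[%classic `|` `]-oo, - x]%classic.
  apply/seteqP; split => y /=; rewrite !in_itv/= ?andbT ler_normr.
    by move=> /orP[] h; [left|right]; lra.
  by case=> h; apply/orP; [left|right]; lra.
by apply: measurableU; exact: measurable_itv.
Qed.

Lemma measurable_far (R : realType) (m eta : R) :
  measurable ([set y | eta < `|y - m|] : set (measurableTypeR R)).
Proof.
have -> : [set y : R | eta < `|y - m|] = `]m + eta, +oo[%classic `|` `]-oo, m - eta[%classic.
  apply/seteqP; split => x /=; rewrite !in_itv/= ?andbT lter_normr.
    by move=> /orP[] h; [left|right]; lra.
  by case=> h; apply/orP; [left|right]; lra.
by apply: measurableU; exact: measurable_itv.
Qed.

(** Exponential Markov inequality at the rate 1/s, in the form of a comparison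
    with the normal densities whose mean is shifted by one standard deviation. *)
Lemma normal_prob_far (R : realType) (m s eta : R) : 0 < s ->
  fine (normal_prob m s [set x | eta < `|x - m|]) <= 2 * expR (1 / 2 - eta / s).
Proof.
move=> s0.
have sn0 : s != 0 by rewrite gt_eqF.
set U := `]m + eta, +oo[%classic : set (measurableTypeR R).
set L := `]-oo, m - eta[%classic : set (measurableTypeR R).
have mU : measurable U by exact: measurable_itv.
have mL : measurable L by exact: measurable_itv.
have -> : [set x | eta < `|x - m|] = U `|` L.
  apply/seteqP; rewrite /U /L; split => x /=; rewrite !in_itv/= ?andbT lter_normr.
    by move=> /orP[] h; [left|right]; lra.
  by case=> h; apply/orP; [left|right]; lra.
rewrite (le_trans (normal_probU_le _ _ mU mL))// mulr_natl mulr2n.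
set c := expR (1 / 2 - eta / s).
have c0 : 0 <= c by exact: expR_ge0.
have key (sg y : R) : sg ^+ 2 = 1 -> eta < sg * (y - m) ->
    normal_pdf m s y <= c * normal_pdf (m + sg * s) s y.
  move=> sg2 h; rewrite !normal_pdfE// /normal_fun mulrCA ler_wpM2l ?normal_peak_ge0//.
  rewrite -expRD ler_expR.
  have -> : - (y - (m + sg * s)) ^+ 2 / (s ^+ 2 *+ 2) =
      - (y - m) ^+ 2 / (s ^+ 2 *+ 2) + sg * (y - m) / s - sg ^+ 2 / 2 by field.
  rewrite sg2.
  have : eta / s <= sg * (y - m) / s by rewrite ler_pM2r ?invr_gt0// ltW.
  lra.
have bnd (m' : R) (A : set (measurableTypeR R)) : measurable A ->
    (forall x, A x -> normal_pdf m s x <= c * normal_pdf m' s x) ->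
    fine (normal_prob m s A) <= c.
  move=> mA h; rewrite (le_trans (normal_prob_le mA c0 h))//.
  by rewrite ler_piMr// normal_prob_le1.
apply: lerD.
  apply: (bnd (m + 1 * s)) => // y; rewrite /U /= in_itv/= andbT => h.
  by apply: key; [rewrite expr1n|lra].
apply: (bnd (m + (-1) * s)) => // y; rewrite /L /= in_itv/= => h.
by apply: key; [rewrite sqrrN expr1n|lra].
Qed.

Lemma integral_itv_reflect (R : realType) (f : R -> R) (a b : R) : a <= b ->
  continuous f ->
  (\int[lebesgue_measure]_(x in `[(- b)%R, (- a)%R]) (f x)%:E =
   \int[lebesgue_measure]_(x in `[a, b]) (f (- x))%:E)%E.
Proof.
move=> ab cf; rewrite integration_by_substitution_oppr//.
exact: continuous_subspaceT.
Qed.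

Lemma pvalue_itv_le (R : realType) (x h : R) : 0 <= h ->
  pvalue x - pvalue (x + h) <= 2 * fine (normal_prob 0 1 `[x, x + h]%classic).
Proof.
move=> h0; rewrite !pvalueE -mulrBr ler_pM2l// lerBlDr.
rewrite (le_trans _ (normal_probU_le _ _ (measurable_itv _) (measurable_itv _)))//.
apply: normal_prob_subset => //; first exact: measurableU.
move=> v /=; rewrite !in_itv/= !andbT => xv.
by have [vh|vh] := leP v (x + h); [left; rewrite ltW|right].
Qed.

(** Folding the density of N(r z, 1 - r^2) at the origin gives, at a point v of
    [x, x + 1], twice the standard density times a hyperbolic cosine of at least
    cosh(r x z) and a Gaussian factor of at least the displayed exponential;
    [x, x + 1] carries almost all of the standard normal tail beyond x. *)
Lemma normal_prob_two_sided_ge (R : realType) (r x z C : R) :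
  0 < r < 1 -> 0 < x -> `|z| <= C ->
  cosh (r * x * z) *
    expR (- ((r * x + r) ^+ 2 + r ^+ 2 * C ^+ 2) / (2 * (1 - r ^+ 2))) *
    (pvalue x - pvalue (x + 1)) <=
  fine (normal_prob (r * z) (Num.sqrt (1 - r ^+ 2)) [set y | x <= `|y|]).
Proof.
move=> /andP[r0 r1] x0 zC.
have s20 : 0 < 1 - r ^+ 2 by rewrite subr_gt0 expr_lt1// ltW.
set s2 := 1 - r ^+ 2 in s20 *; set s := Num.sqrt s2.
have ss : s ^+ 2 = s2 by rewrite sqr_sqrtr// ltW.
have s0 : 0 < s by rewrite sqrtr_gt0.
have sn0 : s != 0 by rewrite gt_eqF.
set K := cosh _ * _.
have K0 : 0 <= K by rewrite mulr_ge0 ?expR_ge0// ltW// cosh_gt0.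
set U : set (measurableTypeR R) := `[x, x + 1]%classic.
set L : set (measurableTypeR R) := `[- (x + 1), - x]%classic.
have mU : measurable U by exact: measurable_itv.
have mL : measurable L by exact: measurable_itv.
pose f := normal_pdf (r * z) s.
have cf : continuous f by exact: continuous_normal_pdf.
have f0 y : 0 <= f y by exact: normal_pdf_ge0.
have mf : measurable_fun [set: measurableTypeR R] f by exact: measurable_normal_pdf.
have mfN : measurable_fun [set: measurableTypeR R] (fun y => f (- y)).
  exact: (measurableT_comp mf).
have mA : measurable ([set y | x <= `|y|] : set (measurableTypeR R)) by exact: measurable_norm_ge.
have sub : U `|` L `<=` [set y | x <= `|y|].
  rewrite /U /L => y /= []; rewrite !in_itv/= ler_normr => /andP[h1 h2]; apply/orP; [left|right]; lra.
rewrite (le_trans _ (normal_prob_subset _ _ _ _ sub))//; last exact: measurableU.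
rewrite normal_probU//; last first.
  rewrite -subset0 /U /L => y /= []; rewrite !in_itv/= => /andP[h1 h2] /andP[h3 h4]; lra.
rewrite (le_trans (ler_wpM2l K0 (pvalue_itv_le x ler01)))//.
rewrite mulrA -lee_fin EFinD EFinM !normal_prob_fin// /normal_prob.
(* Reflect the interval of negative values onto [x, x + 1]. *)
rewrite [X in (_ <= _ + X)%E](_ : _ = \int[lebesgue_measure]_(y in U) (f (- y))%:E)%E; last first.
  by apply: integral_itv_reflect => //; lra.
rewrite -ge0_integralD//; last 4 first.
- by move=> y _; rewrite lee_fin.
- by apply/measurable_funTS/measurable_EFinP.
- by move=> y _; rewrite lee_fin.
- by apply/measurable_funTS/measurable_EFinP.
rewrite -ge0_integralZl//; last 3 first.
- by apply/measurable_funTS/measurable_EFinP; exact: measurable_normal_pdf.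
- by move=> y _; rewrite lee_fin normal_pdf_ge0.
- by rewrite lee_fin mulr_ge0.
apply: ge0_le_integral => //.
- by move=> y _; rewrite -EFinM lee_fin mulr_ge0 ?normal_pdf_ge0// mulr_ge0.
- apply: measurable_funeM.
  by apply/measurable_funTS/measurable_EFinP; exact: measurable_normal_pdf.
- by apply: emeasurable_funD; apply/measurable_funTS/measurable_EFinP.
move=> y; rewrite /U /= in_itv/= => /andP[xy yx].
rewrite -EFinM -EFinD lee_fin -/(phi y) phiE /f !normal_pdfE// /normal_fun ss.
rewrite -mulrDr mulrCA.
apply: ler_pM; rewrite ?normal_peak_ge0 ?mulr_ge0 ?expR_ge0//.
  rewrite /normal_peak ler_pV2 ?inE ?unitfE ?gt_eqF ?sqrtr_gt0 ?mulrn_wgt0 ?mulr_gt0 ?pi_gt0 ?exprn_gt0//.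
  rewrite ler_wsqrtr// ss expr1n lerMn2r/= ler_wpM2r ?pi_ge0//.
  by rewrite /s2 gerBl sqr_ge0.
have s2n0 : s2 != 0 by rewrite gt_eqF.
have rs : r ^+ 2 = 1 - s2 by rewrite /s2 opprB addrC subrK.
set w := r * y.
set D := - y ^+ 2 / 2 - (w ^+ 2 + r ^+ 2 * z ^+ 2) / (2 * s2).
have -> : - (y - r * z) ^+ 2 / (s2 *+ 2) = w * z / s2 + D.
  rewrite /D /w exprMn rs; apply/eqP; rewrite -subr_eq0; apply/eqP.
  have -> : (y - r * z) ^+ 2 = y ^+ 2 - 2 * (r * y * z) + r ^+ 2 * z ^+ 2 by ring.
  by rewrite rs; field.
have -> : - (- y - r * z) ^+ 2 / (s2 *+ 2) = - (w * z / s2) + D.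
  rewrite /D /w exprMn rs; apply/eqP; rewrite -subr_eq0; apply/eqP.
  have -> : (- y - r * z) ^+ 2 = y ^+ 2 + 2 * (r * y * z) + r ^+ 2 * z ^+ 2 by ring.
  by rewrite rs; field.
rewrite (expRD _ D) (expRD _ D) -mulrDl.
have -> : expR (w * z / s2) + expR (- (w * z / s2)) = cosh (w * z / s2) * 2.
  by rewrite /cosh divfK.
have hc : cosh (r * x * z) <= cosh (w * z / s2).
  apply: le_cosh; rewrite /w [`|r * y * z / s2|]normrM normfV !normrM.
  rewrite (gtr0_norm r0) (gtr0_norm x0) (gtr0_norm s20) (gtr0_norm (lt_le_trans x0 xy)).
  rewrite ler_pdivlMr// (@le_trans _ _ (r * x * `|z|))//.
    by rewrite ler_piMr ?mulr_ge0 ?(ltW r0) ?(ltW x0)// /s2 gerBl sqr_ge0.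
  by rewrite ler_wpM2r// ler_pM2l.
have he : expR (- ((r * x + r) ^+ 2 + r ^+ 2 * C ^+ 2) / (2 * s2)) * expR (- y ^+ 2 / 2) <=
    expR D.
  rewrite -expRD ler_expR /D addrC lerD2l mulNr lerN2.
  rewrite ler_pM2r ?invr_gt0 ?mulr_gt0// lerD//.
    apply: lerXn2r; rewrite ?nnegrE /w ?addr_ge0 ?mulr_ge0 ?(ltW r0) ?(ltW x0) ?(ltW (lt_le_trans x0 xy))//.
    by rewrite (_ : r * x + r = r * (x + 1)) ?ler_pM2l// mulrDr mulr1.
  rewrite ler_wpM2l ?sqr_ge0// -real_normK ?num_real//.
  by apply: lerXn2r; rewrite ?nnegrE// (le_trans _ zC).
have c1 := ltW (cosh_gt0 (r * x * z)).
move: hc he c1; rewrite /K; set c := cosh _; set c' := cosh _.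
set E := expR (- _ / _); set g := expR _ => hc he c1.
rewrite (_ : c * E * 2 * g = c * (E * g) * 2); last by ring.
rewrite (_ : c' * 2 * expR D = c' * expR D * 2); last by ring.
by rewrite ler_pM2r// ler_pM// mulr_ge0 ?expR_ge0.
Qed.

(** * The false discovery proportion on the good event *)

(** There are nn l alternatives in the groups l, l + 1, ..., so the alternative
    of index j belongs to the last l with j < nn l.  Working with the cumulated
    sizes nn allows empty groups and equal thresholds x_l. *)
Definition group m (nn : nat -> nat) j : nat := \max_(l < m | (j < nn l)%N) l.

Lemma le_group m (nn : nat -> nat) j k :
  (k < m)%N -> (j < nn k)%N -> (k <= group m nn j)%N.
Proof.
move=> km jk.
exact: (@leq_bigmax_cond _ [pred l : 'I_m | (j < nn l)%N] (fun l => l : nat) (Ordinal km)).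
Qed.

Lemma group_spec m (nn : nat -> nat) j : (0 < m)%N -> (j < nn 0)%N ->
  (group m nn j < m)%N /\ (j < nn (group m nn j))%N.
Proof.
move=> m0 j0; rewrite /group.
have [l lP ->] : {l : 'I_m | (j < nn l)%N &
    \max_(l < m | (j < nn l)%N) (l : nat) = l}%N.
  apply: (@eq_bigmax_cond _ [pred l : 'I_m | (j < nn l)%N]).
  by apply/card_gt0P; exists (Ordinal m0).
by split.
Qed.

Lemma card_ord_sum (R : realType) n (Q : pred 'I_n) :
  #|[set i | Q i]%SET|%:R = \sum_(i < n) (Q i)%:R :> R.
Proof.
rewrite -sum1_card natr_sum [LHS]big_mkcond; apply: eq_bigr => i _.
by rewrite inE; case: (Q i).
Qed.

Lemma sum_ltn_ord n k : (k <= n)%N -> (\sum_(i < n) (i < k) = k)%N.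
Proof.
move=> kn; rewrite -{2}[k]card_ord -sum1_card (big_ord_widen n (fun=> 1%N) kn).
by rewrite [RHS]big_mkcond; apply: eq_bigr => i _; case: (i < k)%N.
Qed.

(** The coordinates i < nn 0 are the alternatives and the others true nulls.
    An alternative of group l has the mean x_l + y_(l+1): since its loading is
    close to -1, it crosses x_l when the factor crosses y_(l+1). *)
Definition alt_mean (R : realType) m (nn : nat -> nat) (x y : nat -> R) i : R :=
  if (i < nn 0)%N then x (group m nn i) + y (group m nn i).+1 else 0.

(** The deterministic core.  For a factor z inside the cell k, the alternatives
    of groups >= k exceed x_k; together with the nulls counted in the
    hypothesis they put N p(x_k) / q p-values below p(x_k).  At a larger level,
    either only groups >= k contribute, and nn k is small enough, or the last
    contributing alternative belongs to a group l < k: it satisfies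
    |T| <= x_l - e, so the level is at least p(x_l - e), against which the nn l
    alternatives involved are negligible. *)
Lemma FDP_good_event (R : realType) (q : R) n m (nn : nat -> nat) (x y be : nat -> R)
    (e C z : R) (t : n.-tuple (measurableTypeR R)) k :
  let N : R := (1 + n)%:R in
  0 < q -> (k < m)%N -> (nn 0 <= n)%N -> 0 < e -> `|z| <= C ->
  {homo nn : i j / (i <= j)%N >-> (j <= i)%N} ->
  {homo x : i j / (i <= j)%N >-> i <= j} -> {homo y : i j / (i <= j)%N >-> i <= j} ->
  (forall l, `|y l| <= C) -> (forall l, 2 * C + 2 * e <= x l) ->
  (forall l, 0 < be l <= 1) ->
  (forall l, pvalue (x l) <= be k * pvalue (x l - e)) ->
  (forall l, (nn l)%:R <= N * (be l * pvalue (x l) / q) < (nn l)%:R + 1) ->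
  y k + 2 * e < z < y k.+1 - 2 * e ->
  N * ((1 - be k) * pvalue (x k) / q) + 1 <=
    \sum_(i < n | (nn 0 <= i)%N) \1_[set u | x k <= `|u|] (tnth t i) ->
  (forall i : 'I_n, (i < nn 0)%N ->
     `|tnth t i - (alt_mean m nn x y i - z)| <= e) ->
  1 - be k <= FDP q (factor_mean n (alt_mean m nn x y))
    (two_sided_pvalues (tuple_cons (z, t) : (1 + n).-tuple _)).
Proof.
move=> N q0 km nn0 e0 zC hnn hx hy yC xC be01 px nnE /andP[zy yz] cnt alt.
have C0 : 0 <= C by rewrite (le_trans _ zC).
have x0 l : 0 <= x l by have := xC l; lra.
have m0 : (0 < m)%N by exact: leq_ltn_trans km.
have N0 : 0 < N by rewrite ltr0n.
set P := two_sided_pvalues _.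
have PE (i : 'I_n) : P (lift ord0 i) = pvalue `|tnth t i|.
  by rewrite /P /two_sided_pvalues tnthS.
have altE (i : 'I_n) : (i < nn 0)%N ->
    alt_mean m nn x y i = x (group m nn i) + y (group m nn i).+1.
  by move=> i0; rewrite /alt_mean i0.
have belowE c : #|[set i | (P i <= c)%R]%SET|%:R =
    (P (@ord0 n) <= c)%R%:R + \sum_(i < n) (pvalue `|tnth t i| <= c)%R%:R :> R.
  rewrite card_ord_sum big_ord_recl; congr (_ + _).
  by apply: eq_bigr => i _; rewrite PE.
have tk : N * pvalue (x k) / q <= #|[set i | (P i <= pvalue (x k))%R]%SET|%:R.
  have -> : N * pvalue (x k) / q = N * (be k * pvalue (x k) / q) +
      N * ((1 - be k) * pvalue (x k) / q) by field; rewrite gt_eqF.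
  apply: (@le_trans _ _ ((nn k)%:R + \sum_(i < n | (nn 0 <= i)%N)
      \1_[set u | x k <= `|u|] (tnth t i))).
    by have /andP[_ h] := nnE k; lra.
  rewrite belowE ler_wpDl//.
  have -> : (nn k)%:R = \sum_(i < n) (i < nn k)%:R :> R.
    have kn : (nn k <= n)%N by rewrite (leq_trans _ nn0)// hnn.
    by rewrite -natr_sum sum_ltn_ord.
  rewrite [X in _ + X <= _]big_mkcond -big_split/=; apply: ler_sum => i _.
  have nulls : x k <= `|tnth t i| -> pvalue `|tnth t i| <= pvalue (x k).
    exact: le_pvalue.
  have [ik|ik] := ltnP i (nn k).
    have i0 : (i < nn 0)%N by rewrite (leq_trans ik)// hnn.
    rewrite leqNgt i0 addr0 /= nulls// (le_trans _ (ler_norm _))//.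
    have := alt i i0; rewrite altE// ler_norml => /andP[h _].
    have kg := le_group km ik.
    have := hx _ _ kg; have := hy k.+1 (group m nn i).+1 kg; lra.
  rewrite add0r; case: ifP => // _; rewrite indicE.
  have [xi|xi] := leP (x k) `|tnth t i|; first by rewrite nulls// mem_set.
  by rewrite memNset//=; apply/negP; rewrite -ltNge.
have c0 : (0 < #|[set i | (P i <= pvalue (x k))%R]%SET|)%N.
  rewrite -(ltr0n R) (lt_le_trans _ tk)// divr_gt0// mulr_gt0//.
  exact: pvalue_gt0.
apply: (FDP_ge q0 c0 tk) => m' cm'.
set tau := q * m'%:R / _.
have tauE : N * tau / q = m'%:R.
  by rewrite /tau; field; rewrite !gt_eqF.
have tkm : N * pvalue (x k) / q <= m'%:R by rewrite (le_trans tk)// ler_nat.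
have sub l : (forall i : 'I_n, (i < nn 0)%N -> pvalue `|tnth t i| <= tau ->
      (i < nn l)%N) ->
    #|[set i in [set i | (P i <= tau)%R] | (factor_mean n (alt_mean m nn x y) 0 i != 0)%R]%SET|%:R
      <= (nn l)%:R :> R.
  move=> h; rewrite card_ord_sum big_ord_recl.
  have ln : (nn l <= n)%N by rewrite (leq_trans _ nn0)// hnn.
  rewrite -[leRHS]add0r -[in leRHS](sum_ltn_ord ln) natr_sum lerD//.
    rewrite !inE [_ != 0](_ : _ = false) ?andbF//.
    by apply/negbTE; rewrite negbK mxE; case: splitP => // j _; rewrite mxE.
  apply: ler_sum => i _; rewrite !inE PE.
  have -> : factor_mean n (alt_mean m nn x y) 0 (lift ord0 i) = alt_mean m nn x y i.
    rewrite mxE; case: splitP => [j /= ij|j /= [ij]]; last by move: ij; rewrite !add0n mxE => ->.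
    by have := ltn_ord j; rewrite -ij.
  have [i0|i0] := ltnP i (nn 0); last by rewrite /alt_mean ltnNge i0 eqxx andbF.
  by have [it|//] := leP (pvalue _) tau; rewrite (h i i0 it); case: (_ != 0).
(* Does the level tau reach an alternative of a group below k? *)
have [/forallP all_k|] := boolP [forall i : 'I_n, (i < nn 0)%N ==>
    (pvalue `|tnth t i| <= tau) ==> (i < nn k)%N].
  rewrite (le_trans (sub k _))//.
    by move=> i i0 it; have := all_k i; rewrite i0 it.
  have /andP[h _] := nnE k; rewrite (le_trans h)//.
  rewrite [leLHS](_ : _ = be k * (N * pvalue (x k) / q)); last by field; rewrite gt_eqF.
  by rewrite ler_pM2l//; have /andP[] := be01 k.
rewrite negb_forall => /existsP[i1].
rewrite !negb_imply => /and3P[i10 i1t i1k].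
(* The last alternative reached has the smallest group index. *)
case: (@arg_maxnP _ i1 [pred i : 'I_n | (i < nn 0)%N && (pvalue `|tnth t i| <= tau)]
  (fun i => i : nat)) => /=; first by rewrite i10 i1t.
move=> i /andP[i0 it] imax.
have ik : (nn k <= i)%N.
  by rewrite (leq_trans _ (imax i1 _)) ?i10 ?i1t// leqNgt.
have [gm ig] := group_spec m0 i0.
set l := group m nn i in gm ig *.
have lk : (l < k)%N.
  rewrite ltnNge; apply/negP => kl.
  by have := leq_ltn_trans ik ig; rewrite ltnNge hnn.
rewrite (le_trans (sub l _))//.
  by move=> j j0 jt; rewrite (leq_ltn_trans (imax j _) ig)// j0.
have /andP[h _] := nnE l; rewrite (le_trans h)//.
have /andP[bk0 _] := be01 k; have /andP[bl0 bl1] := be01 l.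
rewrite [leLHS](_ : _ = N * (be l * pvalue (x l)) / q); last by field; rewrite gt_eqF.
rewrite -tauE [leRHS](_ : _ = N * (be k * tau) / q); last by field; rewrite gt_eqF.
rewrite ler_pM2r ?invr_gt0// ler_pM2l//.
rewrite (@le_trans _ _ (pvalue (x l)))//.
  by rewrite ler_piMl// ltW// pvalue_gt0.
rewrite (le_trans (px l))// ler_pM2l//.
rewrite (le_trans _ it)//; apply: le_pvalue.
have := alt i i0; rewrite altE// -/l ler_norml => /andP[h1 h2].
have := hy l.+1 k lk; have := xC l; have := yC l.+1.
move: zC; rewrite !ler_norml => /andP[? ?] /andP[? ?] ? ?.
by apply/andP; split; lra.
Qed.

(** * Conditional expectation of the false discovery proportion given the factor *)

(** Alternatives move against the factor, so that a large factor leaves fewer of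
    them beyond the thresholds. *)
Definition loading (R : realType) J (r rho : R) i : R :=
  if (i < J)%N then - rho else r.

Lemma prod_null_le (R : realType) n J (u : R) (pA : nat -> R) (p : R) :
  (J <= n)%N -> 0 <= u <= 1 -> 0 <= p -> (forall i, (J <= i)%N -> p <= pA i <= 1) ->
  \prod_(i < n | (J <= i)%N) (1 - u * pA i) <= expR (- (u * p * (n - J)%:R)).
Proof.
move=> Jn /andP[u0 u1] p0 hp.
have -> : (n - J)%:R = \sum_(i < n | (J <= i)%N) 1 :> R.
  have H : (\sum_(i < n) (i < J) + \sum_(i < n) (J <= i) = n)%N.
    rewrite -big_split/= (eq_bigr (fun=> 1%N)) => [|i _].
      by rewrite sum1_card card_ord.
    by rewrite (leqNgt J i); case: (i < J)%N.
  rewrite [RHS]big_mkcond /= (eq_bigr (fun i : 'I_n => (J <= i)%N%:R)) => [|i _].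
    by rewrite -natr_sum -{1}H sum_ltn_ord// addnC addnK.
  by case: ifP.
rewrite mulr_sumr -sumrN expR_sum; apply: ler_prod => i Ji.
have /andP[h1 h2] := hp i Ji.
rewrite subr_ge0 mulr_ile1//= ?(le_trans p0)//.
by rewrite mulr1 (le_trans _ (expR_ge1Dx _))// lerD2l lerN2 ler_wpM2l.
Qed.

(** The two subtracted terms bound the probability that too few nulls exceed
    x_k and the probability that some alternative strays by more than e from
    its conditional position theta_j - z; half of e absorbs the difference
    between the loading -rho and -1. *)
Lemma cond_FDP_ge (R : realType) (q : R) n m (nn : nat -> nat) (x y be : nat -> R)
    (e C z r rho lam p : R) k :
  let N : R := (1 + n)%:R in
  let th := alt_mean m nn x y in
  let b := loading (nn 0) r rho in
  0 < q -> (k < m)%N -> (nn 0 <= n)%N -> 0 < e -> `|z| <= C ->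
  {homo nn : i j / (i <= j)%N >-> (j <= i)%N} ->
  {homo x : i j / (i <= j)%N >-> i <= j} -> {homo y : i j / (i <= j)%N >-> i <= j} ->
  (forall l, `|y l| <= C) -> (forall l, 2 * C + 2 * e <= x l) ->
  (forall l, 0 < be l <= 1) ->
  (forall l, pvalue (x l) <= be k * pvalue (x l - e)) ->
  (forall l, (nn l)%:R <= N * (be l * pvalue (x l) / q) < (nn l)%:R + 1) ->
  y k + 2 * e < z < y k.+1 - 2 * e ->
  0 < r < 1 -> 0 < rho < 1 -> (1 - rho) * C <= e / 2 ->
  0 <= lam -> 0 <= p ->
  p <= fine (normal_prob (r * z) (Num.sqrt (1 - r ^+ 2)) [set u | x k <= `|u|]) ->
  ((1 - be k - (expR (lam * (N * ((1 - be k) * pvalue (x k) / q) + 1)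
       - (1 - expR (- lam)) * p * (n - nn 0)%:R)
     + (nn 0)%:R * (2 * expR (1 / 2 - e / 2 / Num.sqrt (1 - rho ^+ 2)))))%:E <=
   \int[lebesgue_tuple R n]_t
     (FDP q (factor_mean n th) (two_sided_pvalues (tuple_cons (z, t) : (1 + n).-tuple _)) *
      cond_density th b z t)%:E)%E.
Proof.
move=> N th b q0 km nn0 e0 zC hnn hx hy yC xC be01 px nnE yzy r01 rho01 rhoC lam0 p0 pA.
have b1 i : b i ^+ 2 < 1.
  rewrite /b /loading; case: ifP => _; rewrite ?sqrrN.
    by have /andP[? ?] := rho01; rewrite expr_lt1// ltW.
  by have /andP[? ?] := r01; rewrite expr_lt1// ltW.
pose f i := normal_pdf (th i + b i * z) (Num.sqrt (1 - b i ^+ 2)).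
set A : set (measurableTypeR R) := [set u | x k <= `|u|] in pA.
pose B i : set (measurableTypeR R) := [set u | e < `|u - (th i - z)|].
have mA : measurable A by exact: measurable_norm_ge.
have mB i : measurable (B i) by exact: measurable_far.
pose pr i (D : set (measurableTypeR R)) :=
  fine (normal_prob (th i + b i * z) (Num.sqrt (1 - b i ^+ 2)) D).
have [bk0 bk1] := andP (be01 k).
set F := fun t : n.-tuple (measurableTypeR R) => FDP q (factor_mean n th)
  (two_sided_pvalues (tuple_cons (z, t) : (1 + n).-tuple _)).
have mF : measurable_fun setT F.
  have mF' := measurable_FDP_two_sided (factor_mean n th) (ltW q0).
  apply: (measurableT_comp mF').
  by apply: (measurableT_comp (@measurable_tuple_cons R n)); exact: measurable_pair1.
have mf i : measurable_fun [set: measurableTypeR R] (f i).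
  exact: measurable_normal_pdf.
have f0 i (u : measurableTypeR R) : 0 <= f i u by exact: normal_pdf_ge0.
have f1 i : (\int[lebesgue_measure]_u (f i u)%:E = 1)%E.
  exact: integral_normal_pdf.
have fpr i (D : set (measurableTypeR R)) : measurable D ->
    (\int[lebesgue_measure]_(u in D) (f i u)%:E = (pr i D)%:E)%E.
  by move=> mD; rewrite /pr normal_prob_fin.
have F0 t : 0 <= F t by exact: FDP_ge0.
have v01 : 0 <= 1 - be k <= 1 by apply/andP; split; lra.
have vF (t : n.-tuple (measurableTypeR R)) : N * ((1 - be k) * pvalue (x k) / q) + 1 <=
      \sum_(i < n | (nn 0 <= i)%N) \1_A (tnth t i) ->
    (forall i : 'I_n, (i < nn 0)%N -> ~ B i (tnth t i)) -> 1 - be k <= F t.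
  move=> cnt nB; apply: (FDP_good_event (m := m) (C := C) (e := e) (z := z) (k := k)) => //.
  by move=> i i0; rewrite leNgt; apply/negP => /(nB _ i0).
have := @integral_density_good_event_ge R n (nn 0) f A B (pr ^~ A) (fun i => pr i (B i)) F
  _ lam _ nn0 mf f0 f1 mA mB (fun i => fpr i A mA) (fun i => fpr i _ (mB i)) lam0 mF F0 v01 vF.
apply: le_trans.
rewrite lee_fin lerD2l lerN2 lerD//.
  rewrite expRD ler_wpM2l ?expR_ge0//.
  apply: (prod_null_le (pA := fun i => pr i A)) => //.
    by rewrite subr_ge0 -{1}expR0 ler_expR oppr_le0 lam0/= gerBl expR_ge0.
  move=> i Ji; rewrite /pr /th /alt_mean /b /loading ltnNge Ji/= add0r pA/=.
  exact: normal_prob_le1.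
have -> : (nn 0)%:R * (2 * expR (1 / 2 - e / 2 / Num.sqrt (1 - rho ^+ 2))) =
    \sum_(i < nn 0) (2 * expR (1 / 2 - e / 2 / Num.sqrt (1 - rho ^+ 2))).
  by rewrite sumr_const card_ord mulr_natl.
apply: ler_sum => i _; rewrite /pr.
have bi : b i = - rho by rewrite /b /loading ltn_ord.
have s0 : 0 < Num.sqrt (1 - rho ^+ 2).
  by rewrite sqrtr_gt0 subr_gt0; have := b1 i; rewrite bi sqrrN.
rewrite bi sqrrN; apply: le_trans (normal_prob_far (th i + - rho * z) (e / 2) s0).
apply: normal_prob_subset => //; first exact: measurable_far.
move=> u; rewrite /B /= !lter_normr => h.
have [h1 h2] : (1 - rho) * z <= e / 2 /\ - (e / 2) <= (1 - rho) * z.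
  move: zC; rewrite ler_norml => /andP[z1 z2].
  by have /andP[? ?] := rho01; split; nra.
by case/orP: h => h; apply/orP; [left|right]; lra.
Qed.

(** * Choice of the loadings and of the sample size *)

(** The ratio at y of the density of |N(a, 1)| to that of |N(0, 1)|; M is its
    supremum over a >= 0. *)
Definition lik_ratio (R : realType) (a y : R) : R := expR (- a ^+ 2 / 2) * cosh (a * y).

(** One factor g pays for replacing a + r, C and 1 - r^2 by a, 0 and 1 in the
    exponent, the other for cutting the tail at a/r + 1. *)
Lemma null_prob_ge (R : realType) (g r a z C A : R) :
  0 < g < 1 -> 0 < r < 1 -> 0 < a <= A -> `|z| <= C ->
  r * (2 * A + 1 + C ^+ 2 + A ^+ 2 + 2 * - ln g) <= 2 * - ln g ->
  pvalue (a / r + 1) <= (1 - g) * pvalue (a / r) ->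
  g ^+ 2 * lik_ratio a z * pvalue (a / r) <=
  fine (normal_prob (r * z) (Num.sqrt (1 - r ^+ 2)) [set y | a / r <= `|y|]).
Proof.
move=> /andP[g0 g1] r01 /andP[a0 aA] zC rd px; have /andP[r0 r1] := r01.
have ar : r * (a / r) = a by rewrite mulrC divfK// gt_eqF.
have ar0 : 0 < a / r by rewrite divr_gt0.
apply: le_trans (normal_prob_two_sided_ge r01 ar0 zC); rewrite ar.
have C0 : 0 <= C by rewrite (le_trans _ zC).
have r20 : 0 < 1 - r ^+ 2 by rewrite subr_gt0 expr_lt1// ltW.
have d0 : 0 < - ln g by rewrite oppr_gt0 ln_lt0// g0.
have hE : g * expR (- a ^+ 2 / 2) <=
    expR (- ((a + r) ^+ 2 + r ^+ 2 * C ^+ 2) / (2 * (1 - r ^+ 2))).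
  rewrite -{1}[g]lnK ?posrE// -expRD ler_expR.
  rewrite ler_pdivlMr ?mulr_gt0//.
  move: d0 rd; set d := ln g => d0 rd.
  have : 2 * a * r <= 2 * A * r by rewrite ler_pM2r// ler_pM2l.
  have : r ^+ 2 <= r by rewrite expr2 ler_piMr// ltW.
  have aA2 : a ^+ 2 <= A ^+ 2 by rewrite lerXn2r// nnegrE ltW// (lt_le_trans a0).
  have : r ^+ 2 * (1 + C ^+ 2 + A ^+ 2 + 2 * - d) <= r * (1 + C ^+ 2 + A ^+ 2 + 2 * - d).
    rewrite ler_wpM2r//; last by rewrite expr2 ler_piMr// ltW.
    by rewrite !addr_ge0 ?sqr_ge0// mulr_ge0// ltW.
  have : r ^+ 2 * a ^+ 2 <= r ^+ 2 * A ^+ 2 by rewrite ler_wpM2l ?sqr_ge0.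
  nra.
rewrite /lik_ratio.
rewrite [leLHS](_ : _ = cosh (a * z) * (g * expR (- a ^+ 2 / 2)) * (g * pvalue (a / r)));
  last by ring.
have p0 := pvalue_gt0 (ltW ar0).
have c0 := ltW (cosh_gt0 (a * z)).
apply: ler_pM.
- by rewrite mulr_ge0// mulr_ge0 ?(ltW g0) ?expR_ge0.
- by rewrite mulr_ge0 ?(ltW g0) ?(ltW p0).
- by rewrite ler_wpM2l.
- lra.
Qed.

(** Every requirement on r amounts to a lower bound for a_0 / r, except the one
    of the previous lemma, which is an explicit upper bound for r. *)
Lemma exists_small_loading (R : realType) (a0 A C e q g bmin : R) :
  0 < a0 -> 0 < A -> 0 <= C -> 0 < e -> 0 < q -> 0 < g < 1 -> 0 < bmin ->
  exists r : R, [/\ 0 < r < 1,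
    r * (2 * A + 1 + C ^+ 2 + A ^+ 2 + 2 * - ln g) <= 2 * - ln g &
    forall a, a0 <= a -> [/\ 2 * C + 2 * e <= a / r,
      pvalue (a / r) <= bmin * pvalue (a / r - e),
      pvalue (a / r + 1) <= (1 - g) * pvalue (a / r) &
      pvalue (a / r) / q <= 1 - g]].
Proof.
move=> a00 A0 C0 e0 q0 /andP[g0 g1] bmin0.
have g10 : 0 < 1 - g by rewrite subr_gt0.
have [X1 hX1] := pvalue_shift_small bmin0 e0.
have [X2 hX2] := pvalue_shift_small g10 ltr01.
have [X3 hX3] := exists_pvalue_le (mulr_gt0 g10 q0).
have d0 : 0 < - ln g by rewrite oppr_gt0 ln_lt0// g0.
set D := 2 * A + 1 + C ^+ 2 + A ^+ 2 + 2 * - ln g.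
have D0 : 0 < D.
  have := sqr_ge0 C; have := sqr_ge0 A; rewrite /D; lra.
pose X := Num.max (Num.max X1 X2) (Num.max X3 (Num.max (2 * C + 2 * e) 1)).
have X0 : 0 < X by rewrite !lt_max ltr01 !orbT.
pose r := Num.min (a0 / X) (Num.min (2 * - ln g / D) 2^-1).
have r0 : 0 < r by rewrite !lt_min invr_gt0 !divr_gt0 ?mulr_gt0//=.
have rh : r <= 2^-1 by rewrite !ge_min lexx !orbT.
have rD : r <= 2 * - ln g / D by rewrite !ge_min lexx !orbT.
have rX : r <= a0 / X by rewrite ge_min lexx.
exists r; split.
- by rewrite r0/= (le_lt_trans rh)//; lra.
- by rewrite -ler_pdivlMr.
move=> a aa; have Xa : X <= a / r.
  rewrite ler_pdivlMr// mulrC -ler_pdivlMr// (le_trans rX)// ler_pM2r// invr_gt0//.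
move: Xa; rewrite /X !ge_max => /andP[/andP[h1 h2] /andP[h3 /andP[h4 h5]]].
split => //.
- exact: hX1.
- by have := hX2 (a / r + 1); rewrite addrK; apply; lra.
- by rewrite ler_pdivrMr// hX3.
Qed.

(** The number J of alternatives is already fixed here, so the conditional
    standard deviation s = sqrt(1 - rho^2) may be chosen as small as J requires. *)
Lemma exists_loading_near1 (R : realType) (C e ga : R) J :
  0 <= C -> 0 < e -> 0 < ga ->
  exists rho : R, [/\ 0 < rho < 1, (1 - rho) * C <= e / 2 &
    J%:R * (2 * expR (1 / 2 - e / 2 / Num.sqrt (1 - rho ^+ 2))) <= ga].
Proof.
move=> C0 e0 ga0.
have J0 : 0 < J%:R + 1 :> R by rewrite ltr_wpDl.
pose K := ga / (2 * (J%:R + 1)).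
have K0 : 0 < K by rewrite divr_gt0// mulr_gt0.
pose T := Num.max 1 (1 / 2 - ln K).
have T0 : 0 < T by rewrite lt_max ltr01.
pose s := Num.min (Num.min 2^-1 (e / (2 * (C + 1)))) (e / (2 * T)).
have s0 : 0 < s by rewrite !lt_min invr_gt0 !divr_gt0 ?mulr_gt0//= ltr_wpDl.
have s1 : s <= 2^-1 by rewrite !ge_min lexx.
have sC : s <= e / (2 * (C + 1)) by rewrite !ge_min lexx orbT.
have sT : s <= e / (2 * T) by rewrite !ge_min lexx orbT.
have ss : s ^+ 2 <= s by rewrite expr2 ler_piMr ?(ltW s0)// (le_trans s1)//; lra.
have u0 : 0 < 1 - s ^+ 2 by lra.
pose rho := Num.sqrt (1 - s ^+ 2).
have rr : rho ^+ 2 = 1 - s ^+ 2 by rewrite sqr_sqrtr// ltW.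
have rho0 : 0 < rho by rewrite sqrtr_gt0.
have rho1 : rho < 1.
  rewrite -[X in _ < X]sqrtr1 ltr_sqrt//.
  by have := exprn_gt0 2 s0; lra.
exists rho; split; first by rewrite rho0.
- have h : 1 - rho <= s.
    have : rho ^+ 2 <= rho by rewrite expr2 ler_piMr ?(ltW rho0)// ltW.
    rewrite rr; lra.
  rewrite (@le_trans _ _ (s * C))//; first by rewrite ler_wpM2r.
  move: sC; rewrite ler_pdivlMr; last by rewrite mulr_gt0// ltr_wpDl.
  by nra.
- have -> : Num.sqrt (1 - rho ^+ 2) = s.
    by rewrite rr opprB addrC subrK sqrtr_sqr gtr0_norm.
  have h : expR (1 / 2 - e / 2 / s) <= K.
    rewrite -[K]lnK ?posrE// ler_expR.
    have : T <= e / 2 / s.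
      rewrite ler_pdivlMr//; move: sT; rewrite ler_pdivlMr ?mulr_gt0//; lra.
    by rewrite /T ge_max => /andP[_]; lra.
  rewrite (@le_trans _ _ ((J%:R + 1) * (2 * K)))//.
    by apply: ler_pM; rewrite ?mulr_ge0 ?expR_ge0// ?ler_pM2l// lerDl.
  by rewrite /K le_eqVlt; apply/orP; left; apply/eqP; field; rewrite gt_eqF.
Qed.

(** Given the factor, a null exceeds the threshold with probability at least
    w / g^2, and there are about g N of them; the expected count g^(-1) N w
    beats the required N w + 1 by a constant factor, so the Chernoff bound
    decays exponentially in N, uniformly in w between wmin and W. *)
Lemma exists_sample_size (R : realType) (g wmin W ga : R) :
  0 < g < 1 -> 0 < wmin -> 0 < ga -> let lam := (1 - g) / 2 in
  exists n : nat, let N : R := (1 + n)%:R in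
  forall (w : R) (J : nat), wmin <= w <= W -> J%:R <= N * (1 - g) ->
    (J <= n)%N /\
    expR (lam * (N * w + 1) - (1 - expR (- lam)) * (w / g ^+ 2) * (n - J)%:R) <= ga.
Proof.
move=> /andP[g0 g1] w0 ga0 lam.
have lam0 : 0 < lam by rewrite /lam; lra.
have lam1 : lam < 1 by rewrite /lam; lra.
(* The first bound makes g N >= 1; the second makes the exponent at most ln ga. *)
pose T := Num.max g^-1 ((1 + W / g ^+ 2 - ln ga / lam) * g / (wmin * lam)).
pose n := (Num.truncn T).+1.
exists n => N w J /andP[ww wW] JN.
have TN : T <= N.
  by rewrite /N /n natrD -natr1; have := truncnS_gt T; rewrite -natr1; lra.
move: TN; rewrite /T ge_max => /andP[N1 N2].
have Nn : N = n%:R + 1 by rewrite /N natrD addrC.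
have gN : 1 <= g * N by move: N1; rewrite -ler_pdivrMl// mulr1.
have Jn : (J <= n)%N by rewrite -(ler_nat R); lra.
split=> //; rewrite -[leRHS]lnK ?posrE// ler_expR natrB//.
have hl : lam * (1 - lam) <= 1 - expR (- lam).
  have h1 := expR_ge1Dx lam; have h2 := expRxMexpNx_1 lam.
  have h3 := expR_gt0 (- lam).
  suff : expR (- lam) <= 1 - lam + lam ^+ 2 by lra.
  rewrite -(ler_pM2l (expR_gt0 lam)) h2.
  have : (1 + lam) * (1 - lam + lam ^+ 2) <= expR lam * (1 - lam + lam ^+ 2).
    by rewrite ler_wpM2r//; have := sqr_ge0 lam; lra.
  by apply: le_trans; have := exprn_gt0 3 lam0; lra.
have wp : 0 < w by lra.
have wg : 0 < w / g ^+ 2 by rewrite divr_gt0// exprn_gt0.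
have h : lam * (1 - lam) * (w / g ^+ 2) * (g * N - 1) <=
    (1 - expR (- lam)) * (w / g ^+ 2) * (n%:R - J%:R).
  have l0 : 0 <= lam * (1 - lam) by rewrite mulr_ge0 ?(ltW lam0)// subr_ge0 ltW.
  apply: ler_pM; [exact: mulr_ge0 l0 (ltW wg)|lra|by rewrite ler_pM2r|lra].
rewrite (@le_trans _ _ (lam * (N * w + 1) - lam * (1 - lam) * (w / g ^+ 2) * (g * N - 1)))//.
  by rewrite lerD2l lerN2.
have -> : lam * (N * w + 1) - lam * (1 - lam) * (w / g ^+ 2) * (g * N - 1) =
    lam * (- (N * w * (lam / g)) + 1 + (1 - lam) * (w / g ^+ 2)).
  by rewrite /lam; field; rewrite gt_eqF.
have h4 : N * wmin * (lam / g) <= N * w * (lam / g).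
  apply: ler_wpM2r; first by apply/ltW; exact: divr_gt0.
  by apply: ler_wpM2l => //; exact: ler0n.
have h5 : (1 - lam) * (w / g ^+ 2) <= W / g ^+ 2.
  rewrite (@le_trans _ _ (w / g ^+ 2))//.
    by rewrite ler_piMl ?(ltW wg)//; lra.
  by rewrite ler_pM2r// invr_gt0 exprn_gt0.
rewrite mulrC -ler_pdivlMr//.
have h6 : 1 + W / g ^+ 2 - ln ga / lam <= N * wmin * (lam / g).
  rewrite [leRHS](_ : _ = N * (wmin * lam) / g); last by rewrite !mulrA.
  have wl : 0 < wmin * lam by exact: mulr_gt0.
  by rewrite ler_pdivlMr// -(ler_pdivrMr _ _ wl).
lra.
Qed.

(** * From cells of the factor to the false discovery rate *)

(** The two strips removed from the cell have probability at most their length. *)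
Lemma normal_prob_cell_le (R : realType) (a b e : R) : 0 <= e ->
  fine (normal_prob 0 1 `]a, b[%classic) <=
  fine (normal_prob 0 1 `]a + e, b - e[%classic) + 2 * e.
Proof.
move=> e0.
set I : set (measurableTypeR R) := `]a + e, b - e[%classic.
set U : set (measurableTypeR R) := `[a, a + e]%classic.
set V : set (measurableTypeR R) := `[b - e, b]%classic.
have mI : measurable I by exact: measurable_itv.
have mU : measurable U by exact: measurable_itv.
have mV : measurable V by exact: measurable_itv.
have sub : `]a, b[%classic `<=` (I `|` U) `|` V.
  move=> z; rewrite /I /U /V /= !in_itv/= => /andP[az zb].
  have [h1|h1] := leP z (a + e); first by left; right; rewrite (ltW az).
  have [h2|h2] := leP (b - e) z; first by right; rewrite (ltW zb).
  by left; left.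
have mIU : measurable (I `|` U) by exact: measurableU.
have mIUV : measurable ((I `|` U) `|` V) by exact: measurableU.
apply: (le_trans (normal_prob_subset 0 1 (measurable_itv _) mIUV sub)).
rewrite (le_trans (normal_probU_le _ _ mIU mV))//.
rewrite mulr_natl mulr2n addrA lerD//.
  rewrite (le_trans (normal_probU_le _ _ mI mU))// lerD2l.
  rewrite (le_trans (@normal_prob_itv_le R _ _ _))//; first by rewrite lerDl.
  by rewrite addrC addKr.
rewrite (le_trans (@normal_prob_itv_le R _ _ _))//; first by rewrite gerBl.
by rewrite opprB addrC subrK.
Qed.

Lemma integral_cells (R : realType) m (c : 'I_m -> R) (D : 'I_m -> set (measurableTypeR R)) :
  (forall k, 0 <= c k) -> (forall k, measurable (D k)) ->
  (\int[lebesgue_measure]_z ((\sum_k c k * \1_(D k) z) * phi z)%:E =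
   (\sum_k c k * fine (normal_prob 0 1 (D k)))%:E)%E.
Proof.
move=> c0 mD.
have mphi : measurable_fun [set: measurableTypeR R] (@phi R).
  exact: measurable_normal_pdf.
have phi0 (z : R) : 0 <= phi z by exact: normal_pdf_ge0.
under eq_integral do rewrite mulr_suml -sumEFin.
rewrite ge0_integral_sum//; last 2 first.
- move=> k; apply/measurable_EFinP; apply: measurable_funM => //.
  by apply: measurable_funM => //; exact: measurable_indic.
- by move=> k z _; rewrite lee_fin !mulr_ge0.
rewrite -sumEFin; apply: eq_bigr => k _.
under eq_integral do rewrite -mulrA EFinM.
rewrite ge0_integralZl//; last 3 first.
- apply/measurable_EFinP; apply: measurable_funM => //; exact: measurable_indic.
- by move=> z _; rewrite lee_fin mulr_ge0.
- by rewrite lee_fin.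
rewrite EFinM normal_prob_fin//; congr (_ * _)%E.
rewrite /normal_prob [RHS]integral_mkcond; apply: eq_integral => z _.
by rewrite patchE indicE; case: (z \in D k); rewrite ?mul1r ?mul0r.
Qed.

(** The parameters are chosen in the order e, r, N, rho: the width e of the
    strips removed from the cells, then the loading r of the nulls, which fixes
    the levels p(x_k), then a sample size for the law of large numbers, and last
    the loading -rho of the alternatives, whose number depends on N.  The
    exponent 4 of g collects the losses: two factors from the conditional tail
    of the nulls, two from the sample size. *)
Lemma FDR_cells_ge (R : realType) (q g C A bmin bmax eps : R) m (y a be : nat -> R) :
  0 < q -> 0 < g < 1 -> 0 < eps ->
  {homo y : i j / (i <= j)%N >-> i <= j} -> {homo a : i j / (i <= j)%N >-> i <= j} ->
  {homo be : i j / (i <= j)%N >-> j <= i} ->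
  (forall l, `|y l| <= C) -> (forall l, 0 < a l <= A) ->
  0 < bmin -> bmax < 1 -> (forall l, bmin <= be l <= bmax) ->
  (forall k z, (k < m)%N -> y k < z < y k.+1 ->
     1 - be k <= g ^+ 4 * (q * lik_ratio (a k) z)) ->
  exists (N : nat) (theta : 'rV[R]_N) (Sigma : 'M[R]_N),
    [/\ (0 < N)%N, corrmx Sigma &
      ((\sum_(k < m) (1 - be k) * fine (normal_prob 0 1 `]y k, y k.+1[%classic) - eps)%:E
        <= FDR q theta Sigma)%E].
Proof.
move=> q0 g01 eps0 hy ha hbe yC aA bmin0 bmax1 beb hL.
have C0 : 0 <= C by exact: le_trans (yC 0%N).
have A0 : 0 < A by have /andP[h1 h2] := aA 0%N; exact: lt_le_trans h2.
have a00 : 0 < a 0%N by have /andP[] := aA 0%N.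
have be1 l : be l < 1 by have /andP[_ h] := beb l; exact: le_lt_trans bmax1.
have be0 l : 0 < be l by have /andP[h _] := beb l; exact: lt_le_trans h.
have m10 : 0 < m%:R + 1 :> R by rewrite ltr_wpDl.
(* A cell loses 4 e from its two strips and 2 e from the bad events. *)
pose e := eps / (6 * (m%:R + 1)).
have e0 : 0 < e by rewrite divr_gt0// mulr_gt0.
have [r [r01 rd hr]] := exists_small_loading a00 A0 C0 e0 q0 g01 bmin0.
have /andP[r0 r1] := r01.
pose x l := a l / r.
have hx : {homo x : i j / (i <= j)%N >-> i <= j}.
  by move=> i j ij; rewrite ler_pM2r ?invr_gt0// ha.
have hxr l := hr (a l) (ha _ _ (leq0n l)).
have x0 l : 0 <= x l.
  by have /andP[h _] := aA l; apply/ltW; exact: divr_gt0.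
have p0 l : 0 < pvalue (x l) by exact: pvalue_gt0.
pose w l := (1 - be l) * pvalue (x l) / q.
pose wmin := (1 - bmax) * pvalue (A / r) / q.
have wmin0 : 0 < wmin.
  rewrite divr_gt0// mulr_gt0 ?subr_gt0// pvalue_gt0//.
  by rewrite divr_ge0 ?(ltW A0)// ltW.
have ww l : wmin <= w l <= 1.
  have /andP[g0 g1] := g01.
  have [_ _ _ hq] := hxr l; have /andP[_ bl] := beb l; have /andP[_ al] := aA l.
  apply/andP; split.
    rewrite ler_pM2r ?invr_gt0//; apply: ler_pM.
    - by rewrite subr_ge0 ltW.
    - by apply/ltW/pvalue_gt0; rewrite divr_ge0 ?(ltW A0)// ltW.
    - by rewrite lerD2l lerN2.
    - by apply: le_pvalue; rewrite ler_pM2r ?invr_gt0.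
  rewrite /w -mulrA mulr_ile1// ?subr_ge0 ?(ltW (be1 l))//.
  - by apply/ltW; exact: divr_gt0.
  - by rewrite gerBl ltW.
  - by rewrite (le_trans hq)// gerBl ltW.
have [n] := exists_sample_size 1 g01 wmin0 e0.
set lam := (1 - g) / 2; set N : R := (1 + n)%:R => hn.
have lam0 : 0 <= lam by have /andP[g0 g1] := g01; rewrite /lam; lra.
have N0 : 0 < N by rewrite ltr0n.
pose B l := N * (be l * pvalue (x l) / q).
have B0 l : 0 <= B l by rewrite ltW// mulr_gt0// divr_gt0// mulr_gt0.
pose nn l := Num.truncn (B l).
have nnE l : (nn l)%:R <= B l < (nn l)%:R + 1.
  by rewrite natr1; exact: truncn_itv.
have hnn : {homo nn : i j / (i <= j)%N >-> (j <= i)%N}.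
  move=> i j ij; apply: le_truncn; rewrite ler_pM2l// ler_pM2r ?invr_gt0//.
  apply: ler_pM; rewrite ?(ltW (be0 _)) ?(ltW (p0 _)) ?hbe//.
  by apply: le_pvalue; exact: hx.
have JN : (nn 0%N)%:R <= N * (1 - g).
  have /andP[h _] := nnE 0%N; rewrite (le_trans h)// ler_pM2l//.
  have [_ _ _] := hxr 0%N; apply: le_trans; rewrite -mulrA ler_piMl ?(ltW (be1 _))//.
  by apply/ltW; exact: divr_gt0.
have nn0 : (nn 0%N <= n)%N by have [] := hn (w 0%N) (nn 0%N) (ww 0%N) JN.
have [rho [rho01 rhoC rhoe]] := exists_loading_near1 (nn 0%N) C0 e0 e0.
set th := alt_mean m nn x y; set b := loading (nn 0%N) r rho.
have b1 i : b i ^+ 2 < 1.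
  rewrite /b /loading; case: ifP => _; rewrite ?sqrrN.
    by have /andP[? ?] := rho01; rewrite expr_lt1// ltW.
  by rewrite expr_lt1// ltW.
exists (1 + n)%N, (factor_mean n th), (factor_cov n b); split => //.
  exact: factor_cov_corrmx.
(* Truncated at 0 because the integrand bounding the conditional FDP is nonnegative. *)
pose c (k : 'I_m) := Num.max 0 (1 - be k - 2 * e).
pose D (k : 'I_m) : set (measurableTypeR R) := `]y k + 2 * e, y k.+1 - 2 * e[%classic.
have mD k : measurable (D k) by exact: measurable_itv.
have c0 k : 0 <= c k by rewrite le_max lexx.
pose h (z : measurableTypeR R) : R := \sum_k c k * \1_(D k) z.
have mh : measurable_fun setT h.
  by apply: measurable_sum => k; apply: measurable_funM => //; exact: measurable_indic.
have h0 z : 0 <= h z by apply: sumr_ge0 => k _; rewrite mulr_ge0.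
have := @FDR_factor_model_ge R q n th b h (ltW q0) b1 mh h0.
rewrite integral_cells// => H; apply: le_trans (H _).
  rewrite lee_fin lerBlDr.
  have -> : eps = \sum_(k < m) (6 * e) + 6 * e.
    rewrite sumr_const card_ord -mulr_natl /e; field; rewrite gt_eqF//.
  rewrite addrA -big_split/= ler_wpDr ?mulr_ge0 ?(ltW e0) ?(ltW eps0)//.
  apply: ler_sum => k _.
  have := @normal_prob_cell_le R (y k) (y k.+1) (2 * e) (mulr_ge0 (ler0n _ 2) (ltW e0)).
  set P := fine _; set P' := fine _ => PP'.
  have P'0 : 0 <= P' by exact: normal_prob_ge0.
  have P'1 : P' <= 1 by exact: normal_prob_le1.
  have ck : 1 - be k - 2 * e <= c k by rewrite le_max lexx orbT.
  have bk1 := be1 k; have bk0 := be0 k.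
  have h1 : (1 - be k) * P <= (1 - be k) * (P' + 2 * (2 * e)).
    by rewrite ler_pM2l ?subr_gt0.
  have h2 : (1 - be k - 2 * e) * P' <= c k * P' by rewrite ler_wpM2r.
  have h3 : be k * e >= 0 by rewrite mulr_ge0// ltW.
  have h4 : e * P' <= e by rewrite ler_piMr// ltW.
  by rewrite -/P' ; nra.
move=> z.
have [/existsP[k /asboolP zk]|/existsPn nz] := boolP [exists k : 'I_m, `[< D k z >]]; last first.
  rewrite [h z](_ : _ = 0); last first.
    rewrite /h big1// => k _; rewrite indicE memNset ?mulr0// => zk.
    by have := nz k; rewrite asboolT.
  by apply: integral_ge0 => t _; rewrite lee_fin mulr_ge0 ?FDP_ge0 ?cond_density_ge0.
have := zk; rewrite /D /= in_itv/= => /andP[z1 z2].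
have hz : h z = c k.
  rewrite /h (bigD1 k)//= indicE mem_set// mulr1 big1 ?addr0// => j jk.
  rewrite indicE memNset ?mulr0// /D /= in_itv/= => /andP[z3 z4].
  have [kj|jk'|/val_inj jk'] := ltngtP k j.
  - by have := hy k.+1 j kj; lra.
  - by have := hy j.+1 k jk'; lra.
  - by rewrite jk' eqxx in jk.
rewrite hz /c.
have [neg|pos] := leP (1 - be k - 2 * e) 0.
  by apply: integral_ge0 => t _; rewrite lee_fin mulr_ge0 ?FDP_ge0 ?cond_density_ge0.
have /andP[g0 g1] := g01.
have g20 : 0 < g ^+ 2 by rewrite exprn_gt0.
have zC : `|z| <= C.
  rewrite ler_norml; have := yC k; have := yC k.+1; rewrite !ler_norml.
  by move=> /andP[? ?] /andP[? ?]; apply/andP; split; lra.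
have Fk := hL k z (ltn_ord k) _.
have pk0 : 0 <= w k / g ^+ 2.
  by have /andP[hw _] := ww k; rewrite divr_ge0 ?(ltW g20)// (le_trans _ hw)// ltW.
have pk : w k / g ^+ 2 <=
    fine (normal_prob (r * z) (Num.sqrt (1 - r ^+ 2)) [set u | x k <= `|u|]).
  have [_ _ hp1 _] := hxr k.
  apply: le_trans (null_prob_ge g01 r01 (aA k) zC rd hp1).
  rewrite ler_pdivrMr// /w ler_pdivrMr// -/(x k).
  rewrite [leRHS](_ : _ = g ^+ 4 * (q * lik_ratio (a k) z) * pvalue (x k)); last by ring.
  by rewrite ler_pM2r// Fk//; apply/andP; split; lra.
apply: le_trans (@cond_FDP_ge R q n m nn x y be e C z r rho lam (w k / g ^+ 2) k
  q0 (ltn_ord k) nn0 e0 zC hnn hx hy yC _ _ _ nnE _ r01 rho01 rhoC lam0 pk0 pk).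
- rewrite lee_fin -/N.
  have [_ hk] := hn (w k) (nn 0%N) (ww k) JN.
  by move: hk rhoe; rewrite /w; lra.
- by move=> l; have [] := hxr l.
- by move=> l; rewrite be0 ltW.
- move=> l; have [h1 h2 _ _] := hxr l; rewrite (le_trans h2)// ler_wpM2r//.
    by apply/ltW/pvalue_gt0; have := C0; move: h1; rewrite -/(x l); lra.
  by have /andP[] := beb k.
- by apply/andP; split; lra.
Qed.

(** * The function M and its maximizers *)

Lemma lik_ratio0 (R : realType) (y : R) : lik_ratio 0 y = 1.
Proof. by rewrite /lik_ratio expr0n oppr0 mul0r expR0 mul1r mul0r /cosh oppr0 expR0; lra. Qed.

Lemma lik_ratio_gt0 (R : realType) (a y : R) : 0 < lik_ratio a y.
Proof. by rewrite mulr_gt0 ?expR_gt0 ?cosh_gt0. Qed.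

Lemma cosh_le_expR (R : realType) (x : R) : 0 <= x -> cosh x <= expR x.
Proof.
move=> x0; rewrite /cosh; have : expR (- x) <= expR x by rewrite ler_expR; lra.
lra.
Qed.

Lemma lik_ratio_le (R : realType) (a y : R) : 0 <= a * y ->
  lik_ratio a y <= expR (- a ^+ 2 / 2 + a * y).
Proof.
by move=> ay; rewrite /lik_ratio expRD ler_pM2l ?expR_gt0// cosh_le_expR.
Qed.

Lemma has_sup_lik_ratio (R : realType) (y : R) :
  has_sup [set expR (- a ^+ 2 / 2) * cosh (a * y) | a in [set a : R | 0 <= a]].
Proof.
split; first by exists (lik_ratio 0 y), 0 => //=.
exists (expR (y ^+ 2 / 2)) => _ [a /= a0 <-].
rewrite -(cosh_norm (a * y)) normrM (ger0_norm a0).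
apply: le_trans (lik_ratio_le _) _; first by rewrite mulr_ge0.
rewrite ler_expR -[y ^+ 2]real_normK ?num_real//.
have := sqr_ge0 (a - `|y|); lra.
Qed.

Lemma lik_ratio_le_M (R : realType) (a y : R) : 0 <= a -> lik_ratio a y <= M y.
Proof.
by move=> a0; apply: ub_le_sup; [have [] := has_sup_lik_ratio y|exists a].
Qed.

Lemma M_ge1 (R : realType) (y : R) : 1 <= M y.
Proof. by rewrite -(lik_ratio0 y) lik_ratio_le_M. Qed.

Lemma M_le (R : realType) (y c : R) :
  (forall a : R, 0 <= a -> lik_ratio a y <= c) -> M y <= c.
Proof.
move=> h; apply: ge_sup; first by have [] := has_sup_lik_ratio y.
by move=> _ [a /= a0 <-]; exact: h.
Qed.

Lemma continuous_lik_ratio (R : realType) (y : R) : continuous (fun a : R => lik_ratio a y).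
Proof.
move=> a; apply: cvgM.
  apply: continuous_comp; last exact: continuous_expR.
  by apply: cvgM; [apply: cvgN; exact: exprn_continuous|exact: cvg_cst].
apply: cvgM; last exact: cvg_cst.
apply: cvgD.
  apply: continuous_comp; last exact: continuous_expR.
  exact: mulrr_continuous.
apply: continuous_comp; last exact: continuous_expR.
by apply: cvgN; exact: mulrr_continuous.
Qed.

(** LR(a, y) is at most 1 = LR(0, y) for a >= 2 y, so the supremum is that of a
    continuous function on [0, 2 y]. *)
Lemma M_attained (R : realType) (y : R) : 0 <= y ->
  exists2 a : R, 0 <= a <= 2 * y & M y = lik_ratio a y.
Proof.
move=> y0.
have y20 : 0 <= 2 * y by rewrite mulr_ge0.
have cl : {within `[0, 2 * y], continuous (fun a : R => lik_ratio a y)}.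
  by apply: continuous_subspaceT; exact: continuous_lik_ratio.
have [a] := EVT_max y20 cl; rewrite in_itv/= => a02 amax.
exists a => //; apply/eqP; rewrite eq_le; apply/andP; split; last first.
  by apply: lik_ratio_le_M; case/andP: a02.
apply: M_le => b b0; have [b2|b2] := leP b (2 * y).
  by apply: amax; rewrite in_itv/= b0.
apply: (@le_trans _ _ (lik_ratio 0 y)); last by apply: amax; rewrite in_itv/= lexx.
rewrite lik_ratio0 (le_trans (lik_ratio_le _)) ?mulr_ge0// -[leRHS]expR0 ler_expR.
nra.
Qed.

Lemma le_lik_ratio (R : realType) (a y z : R) : 0 <= a -> 0 <= y <= z ->
  lik_ratio a y <= lik_ratio a z.
Proof.
move=> a0 /andP[y0 yz]; rewrite ler_pM2l ?expR_gt0//; apply: le_cosh.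
by rewrite !normrM ler_wpM2l// !ger0_norm// (le_trans y0).
Qed.

Lemma le_M (R : realType) (y z : R) : 0 <= y <= z -> M y <= M z.
Proof.
move=> yz; apply: M_le => a a0; apply: le_trans (lik_ratio_le_M z a0).
exact: le_lik_ratio.
Qed.

(** Since cosh(u + v) <= e^v cosh(u) for v >= 0, a maximizer at z, which is at
    most 2 z, loses at most this factor at y.  This is the continuity of M in the
    form in which it is used. *)
Lemma M_le_expR (R : realType) (y z : R) : 0 <= y <= z ->
  M z <= expR (2 * z * (z - y)) * M y.
Proof.
move=> /andP[y0 yz]; have z0 : 0 <= z by exact: le_trans yz.
have [a /andP[a0 az] ->] := M_attained z0.
apply: (@le_trans _ _ (expR (2 * z * (z - y)) * lik_ratio a y)); last first.
  by rewrite ler_pM2l ?expR_gt0// lik_ratio_le_M.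
rewrite /lik_ratio [leRHS]mulrCA ler_pM2l ?expR_gt0//.
apply: (@le_trans _ _ (expR (a * (z - y)) * cosh (a * y))); last first.
  rewrite ler_pM2r ?cosh_gt0// ler_expR ler_wpM2r// subr_ge0//.
rewrite /cosh mulrA ler_pM2r// mulrDr -!expRD.
by apply: lerD; rewrite ler_expR; nra.
Qed.

Lemma cosh_prod (R : realType) (u v : R) :
  cosh u * cosh v = (cosh (u + v) + cosh (u - v)) / 2.
Proof.
by rewrite /cosh !opprD opprK !expRD; field.
Qed.

(** LR(a, .) / LR(b, .) is strictly increasing when a > b, so a maximizer cannot
    decrease.  The strict monotonicity is the product formula for cosh together
    with (a - b)(z - y) > 0. *)
Lemma argmax_lik_ratio_mono (R : realType) (y z a b : R) :
  0 <= y < z -> 0 <= a -> 0 <= b ->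
  M y = lik_ratio a y -> M z = lik_ratio b z -> a <= b.
Proof.
move=> /andP[y0 yz] a0 b0 aM bM; rewrite leNgt; apply/negP => ba.
have h1 : lik_ratio b y <= lik_ratio a y by rewrite -aM lik_ratio_le_M.
have h2 : lik_ratio a z <= lik_ratio b z by rewrite -bM lik_ratio_le_M.
have h : cosh (b * y) * cosh (a * z) <= cosh (a * y) * cosh (b * z).
  have := ler_pM (ltW (lik_ratio_gt0 _ _)) (ltW (lik_ratio_gt0 _ _)) h1 h2.
  rewrite /lik_ratio mulrACA [leRHS]mulrACA [expR (- b ^+ 2 / 2) * _]mulrC.
  by rewrite ler_pM2l// mulr_gt0 ?expR_gt0.
suff : cosh (a * y) * cosh (b * z) < cosh (b * y) * cosh (a * z) by lra.
rewrite !cosh_prod ltr_pM2r// ltr_leD//.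
  by apply: lt_cosh; nra.
rewrite -(coshN (b * y - a * z)); apply: le_cosh.
rewrite [leRHS]ger0_norm; last by nra.
by rewrite ler_norml; apply/andP; split; nra.
Qed.

Lemma M_ge_expR (R : realType) (y : R) : 0 <= y -> expR (y ^+ 2 / 2) / 2 <= M y.
Proof.
move=> y0; apply: le_trans (lik_ratio_le_M y y0).
rewrite /lik_ratio /cosh mulrA ler_pM2r// mulrDr -!expRD.
rewrite (_ : - y ^+ 2 / 2 + y * y = y ^+ 2 / 2); last by field.
by rewrite lerDl expR_ge0.
Qed.

(** * Existence of the critical value *)

(** That is cosh a <= e^(a^2/2).  The derivative of LR(., 1) has the sign of
    sinh a - a cosh a, which is nonpositive by the mean value theorem for sinh. *)
Lemma lik_ratio1_le1 (R : realType) (a : R) : 0 <= a -> lik_ratio a 1 <= 1.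
Proof.
move=> a0; rewrite -[leRHS](lik_ratio0 1).
pose sh (x : R) := (expR x - expR (- x)) / 2.
have dN (x : R) : is_derive x 1 (fun x => expR (- x)) (- expR (- x)).
  by rewrite -[- _]mulrN1; apply: (@is_derive1_comp _ expR (fun x => - x)).
have dsh (x : R) : is_derive x 1 sh (cosh x).
  apply: (@is_derive_eq _ _ _ _ _ _ _ _ (is_deriveM _ _)) => /=.
  by rewrite !scaler0 add0r opprK /cosh mulrC.
have dch (x : R) : is_derive x 1 (@cosh R) (sh x).
  apply: (@is_derive_eq _ _ _ _ _ _ _ _ (is_deriveM _ _)) => /=.
  by rewrite !scaler0 add0r /sh mulrC.
have dq (x : R) : is_derive x 1 (fun x => - x ^+ 2 / 2) (- x).
  apply: (@is_derive_eq _ _ _ _ _ _ _ _ (is_deriveM _ _)) => /=.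
  by rewrite !scaler0 add0r /GRing.scale/=; field.
have dg (x : R) : is_derive x 1 (fun x => expR (- x ^+ 2 / 2)) (expR (- x ^+ 2 / 2) * - x).
  exact: (@is_derive1_comp _ expR (fun x => - x ^+ 2 / 2) x _ _ (is_derive_expR _) (dq x)).
have df (x : R) : is_derive x 1 (fun x => expR (- x ^+ 2 / 2) * cosh x)
    (expR (- x ^+ 2 / 2) * (sh x - x * cosh x)).
  apply: (@is_derive_eq _ _ _ _ _ _ _ _ (is_deriveM (dg x) (dch x))) => /=.
  by rewrite /GRing.scale/=; ring.
have der_cont (f df' : R -> R) : (forall x : R, is_derive x 1 f (df' x)) ->
    forall u v : R, {within `[u, v], continuous f}.
  move=> h u v; apply: continuous_subspaceT => x.
  by apply: differentiable_continuous; apply/derivable1_diffP; have [] := h x.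
have sh0 : sh 0 = 0 by rewrite /sh oppr0 subrr mul0r.
have sh_le (x : R) : 0 <= x -> sh x <= x * cosh x.
  move=> x0; have [c] := MVT_segment x0 (fun x _ => dsh x) (der_cont _ _ dsh 0 x).
  rewrite in_itv/= sh0 !subr0 => /andP[c0 cx] ->.
  by rewrite mulrC ler_wpM2l// le_cosh// !ger0_norm.
have [c] := MVT_segment a0 (fun x _ => df x) (der_cont _ _ df 0 a).
rewrite in_itv/= => /andP[c0 ca].
rewrite /lik_ratio !mulr1 => E; rewrite -subr_le0 E subr0 mulr_le0_ge0//.
by rewrite mulr_ge0_le0 ?expR_ge0// subr_le0 sh_le.
Qed.

Lemma M1 (R : realType) : M 1 = 1 :> R.
Proof.
apply/eqP; rewrite eq_le M_ge1 andbT; apply: M_le => a; exact: lik_ratio1_le1.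
Qed.

(** The critical value is the supremum s of the y >= 1 with q M(y) <= 1, a set
    bounded because M(y) >= e^(y^2/2) / 2; by the continuity estimate neither
    q M(s) > 1 nor q M(s) < 1 is possible. *)
Lemma crit_y_spec (R : realType) (q : R) : 0 < q < 1 ->
  1 < crit_y q /\ q * M (crit_y q) = 1.
Proof.
move=> /andP[q0 q1].
suff ex : exists y : R, 1 < y /\ q * M y = 1.
  exact: (@xgetPex _ 0 [set y : R | 1 < y /\ q * M y = 1] ex).
pose S : set R := [set y | 1 <= y /\ q * M y <= 1].
have S1 : S 1 by split=> //; rewrite M1 mulr1 ltW.
have qV1 : 1 < q^-1 by rewrite invf_gt1.
pose Y := 2 * q^-1.
have SY : ubound S Y.
  move=> y [y1 qM]; rewrite leNgt; apply/negP => Yy.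
  have y0 : 0 <= y by rewrite (le_trans _ y1).
  have : q^-1 < M y.
    apply: lt_le_trans (M_ge_expR y0); have := expR_ge1Dx (y ^+ 2 / 2).
    rewrite /Y in Yy; nra.
  by rewrite ltNge -ler_pdivlMl ?mulr1 // ?qM in qM *; rewrite qM.
have supS : has_sup S by split; [exists 1|exists Y].
set s := sup S.
have s1 : 1 <= s by apply: ub_le_sup => //; exists Y.
have s0 : 0 <= s by rewrite (le_trans _ s1).
have Ms0 := lt_le_trans ltr01 (M_ge1 s).
have sE : q * M s = 1.
  apply/eqP; rewrite eq_le; apply/andP; split; rewrite leNgt; apply/negP => h.
  - pose d := ln (q * M s) / (2 * s).
    have d0 : 0 < d by rewrite divr_gt0 ?ln_gt0// mulr_gt0// (lt_le_trans ltr01).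
    have [y [y1 qMy] sy] := sup_adherent d0 supS.
    have ys : y <= s by apply: ub_le_sup => //; exists Y.
    have y0 : 0 <= y by rewrite (le_trans _ y1).
    have My := @M_le_expR R y s; rewrite y0 ys in My; have {}My := My isT.
    have : q * M s < q * M s.
      apply: (le_lt_trans (ler_wpM2l (ltW q0) My)).
      rewrite mulrCA (@le_lt_trans _ _ (expR (2 * s * (s - y))))//.
        by rewrite ler_piMr ?expR_ge0.
      rewrite -[ltRHS]lnK ?posrE ?mulr_gt0// ltr_expR mulrC -ltr_pdivlMr ?mulr_gt0//.
        by rewrite -/d; move: sy; rewrite -/s; lra.
      by rewrite (lt_le_trans ltr01).
    by rewrite ltxx.
  - pose K := - ln (q * M s).
    have K0 : 0 < K by rewrite oppr_gt0 ln_lt0// mulr_gt0.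
    pose d := Num.min 1 (K / (2 * (s + 1))).
    have s10 : 0 < 2 * (s + 1) by rewrite mulr_gt0// ltr_wpDl.
    have d0 : 0 < d by rewrite lt_min ltr01 divr_gt0.
    have d1 : d <= 1 by rewrite ge_min lexx.
    have dK : d * (2 * (s + 1)) <= K by rewrite -ler_pdivlMr// ge_min lexx orbT.
    have : s + d <= s.
      apply: ub_le_sup; [by exists Y|split; first by rewrite (le_trans s1)// lerDl ltW].
      have := @M_le_expR R s (s + d); rewrite s0 lerDl (ltW d0) => My; have {}My := My isT.
      rewrite (le_trans (ler_wpM2l (ltW q0) My))// mulrCA.
      rewrite -[q * M s]lnK ?posrE ?mulr_gt0// -expRD -[leRHS]expR0 ler_expR.
      have : 2 * (s + d) * (s + d - s) <= d * (2 * (s + 1)).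
        rewrite (_ : s + d - s = d); last by ring.
        by rewrite mulrC ler_wpM2l ?(ltW d0)// ler_pM2l// lerD2l.
      by rewrite /K in dK; lra.
    by rewrite leNgt ltrDl d0.
exists s; split => //; rewrite lt_neqAle s1 andbT; apply/negP => /eqP s1E.
by move: sE; rewrite -s1E M1 mulr1 => qE; rewrite qE ltxx in q1.
Qed.

(** * Riemann sums for the lower bound *)

Lemma normal_prob_cc_le (R : realType) (a b : R) : a <= b ->
  fine (normal_prob 0 1 `[a, b]%classic) <= fine (normal_prob 0 1 `]a, b[%classic).
Proof.
move=> ab.
have sub : `[a, b]%classic `<=` `]a, b[%classic `|` (`[a, a]%classic `|` `[b, b]%classic).
  move=> z /=; rewrite !in_itv/= => /andP[az zb].
  have [<-|az'] := eqVneq a z; first by right; left; rewrite lexx.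
  have [->|zb'] := eqVneq z b; first by right; right; rewrite lexx.
  by left; rewrite !lt_neqAle az az' zb zb'.
have m1 : measurable (`[a, a]%classic `|` `[b, b]%classic : set (measurableTypeR R)).
  by apply: measurableU; exact: measurable_itv.
have mI : measurable (`]a, b[%classic : set (measurableTypeR R)) by exact: measurable_itv.
have mc (c : R) : measurable (`[c, c]%classic : set (measurableTypeR R)).
  exact: measurable_itv.
have c0 (c : R) : fine (normal_prob 0 1 `[c, c]%classic) <= 0.
  by have := @normal_prob_itv_le R c c (lexx c); rewrite subrr.
apply: (le_trans (normal_prob_subset 0 1 (measurable_itv _) (measurableU _ _ mI m1) sub)).
apply: (le_trans (normal_probU_le _ _ mI m1)).
rewrite gerDl; apply: (le_trans (normal_probU_le _ _ (mc a) (mc b))).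
by have := c0 a; have := c0 b; lra.
Qed.

(** The division points of [1, Y] into n intervals of equal length. *)
Definition grid (R : realType) (Y : R) n (j : nat) : R :=
  1 + j%:R * ((Y - 1) / n%:R).

(** An upper Riemann sum; M is increasing on [1, Y], hence at most its value at
    the right end of each interval. *)
Lemma integral_M_le (R : realType) (Y : R) n : (0 < n)%N -> 1 <= Y ->
  \int[lebesgue_measure]_(y in `[1, Y]) (M y * phi y) <=
  \sum_(j < n) M (grid Y n j.+1) *
    fine (normal_prob 0 1 `[grid Y n j, grid Y n j.+1]%classic).
Proof.
move=> n0 Y1; set t := grid Y n.
have nR : 0 < n%:R :> R by rewrite ltr0n.
pose h := (Y - 1) / n%:R.
have h0 : 0 <= h by rewrite divr_ge0// subr_ge0.
have t1 j : 1 <= t j by rewrite /t /grid lerDl mulr_ge0.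
have tn : t n = Y by rewrite /t /grid mulrC divfK ?gt_eqF// addrC subrK.
have tS j : t j <= t j.+1 by rewrite /t /grid lerD2l ler_wpM2r// ler_nat.
pose c (j : 'I_n) := M (t j.+1).
pose D (j : 'I_n) : set (measurableTypeR R) := `[t j, t j.+1]%classic.
have mD j : measurable (D j) by exact: measurable_itv.
have c0 j : 0 <= c j by rewrite (le_trans ler01)// M_ge1.
have phi0 (z : R) : 0 <= phi z by exact: normal_pdf_ge0.
have M0 (z : R) : 0 <= M z by rewrite (le_trans ler01)// M_ge1.
have E := integral_cells c0 mD.
have U0 : 0 <= \sum_(j < n) M (t j.+1) * fine (normal_prob 0 1 `[t j, t j.+1]%classic).
  by apply: sumr_ge0 => j _; rewrite mulr_ge0// normal_prob_ge0.
have mphi : measurable_fun [set: measurableTypeR R] (@phi R).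
  exact: measurable_normal_pdf.
have cover (y : R) : 1 <= y <= Y -> exists j : 'I_n, t j <= y <= t j.+1.
  move=> /andP[y1 yY].
  have ex : exists j, (j < n)%N && (y <= t j.+1).
    by exists n.-1; rewrite prednK// leqnn tn.
  have [j /andP[jn yj] jmin] := ex_minnP ex.
  exists (Ordinal jn); rewrite yj andbT /=.
  case: j jn yj jmin => [|j] jn _ jmin; first by rewrite /t /grid mul0r addr0.
  rewrite leNgt; apply/negP => yj.
  by have := jmin j; rewrite (ltnW jn) (ltW yj) ltnn => /(_ isT).
suff : (\int[lebesgue_measure]_(y in `[1%R, Y]) (M y * phi y)%:E <=
    (\sum_(j < n) M (t j.+1) * fine (normal_prob 0 1 `[t j, t j.+1]%classic))%:E)%E.
  move=> I; rewrite /Rintegral -lee_fin fineK//.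
  rewrite ge0_fin_numE; first exact: le_lt_trans I (ltry _).
  by apply: integral_ge0 => y _; rewrite lee_fin mulr_ge0.
rewrite -E.
pose M' (y : measurableTypeR R) : R := M (Num.max 0 y).
have mM' : measurable_fun [set: measurableTypeR R] M'.
  apply: nondecreasing_measurable => // y z yz.
  by apply: le_M; rewrite le_max lexx/= ge_max !le_max lexx yz/= orbT.
rewrite integral_mkcond.
have -> : (\int[lebesgue_measure]_x ((fun y => (M y * phi y)%:E) \_ `[1%R, Y]) x =
    \int[lebesgue_measure]_x (\1_`[1%R, Y] x * (M' x * phi x))%:E)%E.
  apply: eq_integral => y _; rewrite patchE indicE.
  case: ifPn => [|_]; last by rewrite mul0r.
  rewrite inE/= in_itv/= => /andP[y1 _]; rewrite mul1r /M' max_r//.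
  exact: le_trans ler01 y1.
apply: ge0_le_integral => //.
- by move=> y _; rewrite lee_fin !mulr_ge0// M0.
- apply/measurable_EFinP; apply: measurable_funM; first exact: measurable_indic.
  exact: measurable_funM.
- apply/measurable_EFinP; apply: measurable_funM => //.
  by apply: measurable_sum => j; apply: measurable_funM => //; exact: measurable_indic.
move=> y _; rewrite lee_fin mulrA ler_wpM2r// indicE.
have [yI|yI] := boolP (y \in _); last first.
  by rewrite mul0r; apply: sumr_ge0 => j _; rewrite mulr_ge0.
move: yI; rewrite inE/= in_itv/= => /andP[y1 yY].
rewrite mul1r /M' max_r ?(le_trans ler01 y1)//.
have [|j /andP[j1 j2]] := cover y; first by rewrite y1.
rewrite (bigD1 j)//= ler_wpDr//.
  by apply: sumr_ge0 => i _; rewrite mulr_ge0.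
rewrite indicE mem_set ?mulr1; last by rewrite /D /= in_itv/= j1.
by apply: le_M; rewrite (le_trans ler01 y1).
Qed.

Lemma grid_ge1 (R : realType) (Y : R) n j : 1 <= Y -> 1 <= grid Y n j.
Proof. by move=> Y1; rewrite /grid lerDl mulr_ge0// divr_ge0// subr_ge0. Qed.

Lemma le_grid (R : realType) (Y : R) n : 1 <= Y ->
  {homo grid Y n : i j / (i <= j)%N >-> i <= j}.
Proof.
move=> Y1 i j ij; rewrite /grid lerD2l ler_wpM2r ?ler_nat//.
by rewrite divr_ge0// subr_ge0.
Qed.

Lemma grid0 (R : realType) (Y : R) n : grid Y n 0 = 1.
Proof. by rewrite /grid mul0r addr0. Qed.

Lemma grid_last (R : realType) (Y : R) n : (0 < n)%N -> grid Y n n = Y.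
Proof. by move=> n0; rewrite /grid mulrC divfK ?pnatr_eq0 -?lt0n// addrC subrK. Qed.

(** Upper and lower sums of the increasing M differ by a telescoping sum, because
    each interval has probability at most its length. *)
Lemma riemann_M_le (R : realType) (Y : R) n : (0 < n)%N -> 1 <= Y ->
  \sum_(j < n) M (grid Y n j.+1) *
    fine (normal_prob 0 1 `[grid Y n j, grid Y n j.+1]%classic) <=
  \sum_(j < n) M (grid Y n j) *
    fine (normal_prob 0 1 `]grid Y n j, grid Y n j.+1[%classic) +
  (Y - 1) / n%:R * (M Y - 1).
Proof.
move=> n0 Y1; set t := grid Y n.
have nR : 0 < n%:R :> R by rewrite ltr0n.
have tS j : t j <= t j.+1 by exact: le_grid.
have -> : (Y - 1) / n%:R * (M Y - 1) =
    \sum_(j < n) (M (t j.+1) - M (t j)) * ((Y - 1) / n%:R).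
  rewrite -mulr_suml mulrC; congr (_ * _).
  rewrite -(big_mkord xpredT (fun j => M (t j.+1) - M (t j))) telescope_sumr//.
  by rewrite /t grid_last// grid0 M1.
rewrite -big_split/=; apply: ler_sum => j _.
have cc := normal_prob_cc_le (tS j).
have := @normal_prob_itv_le R _ _ (tS j).
rewrite [X in _ <= X](_ : _ = (Y - 1) / n%:R); last first.
  by rewrite /t /grid -natr1; ring.
have Mj : M (t j) <= M (t j.+1).
  by apply: le_M; rewrite tS (le_trans ler01) ?grid_ge1.
have M0 : 0 <= M (t j) by rewrite (le_trans ler01)// M_ge1.
move: cc; set p := fine _; set p' := fine _; set h := _ / _ => cc ph.
have -> : M (t j.+1) * p = M (t j) * p + (M (t j.+1) - M (t j)) * p by ring.
by apply: lerD; [rewrite ler_wpM2l|rewrite ler_wpM2l// subr_ge0].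
Qed.

Lemma exists_small_tail (R : realType) (eps : R) : 0 < eps ->
  exists L0 : R, forall L, L0 <= L ->
    fine (normal_prob 0 1 [set x | L - 1 < `|x - 0|]) <= eps.
Proof.
(* This makes the bound 2 e^(1/2 - (L - 1)) at most eps. *)
move=> eps0; exists (3 / 2 - ln (eps / 2)) => L LL.
rewrite (le_trans (normal_prob_far _ _ ltr01))//.
have -> : eps = 2 * expR (ln (eps / 2)) by rewrite lnK ?posrE ?divr_gt0//; field.
rewrite ler_pM2l// ler_expR divr1; lra.
Qed.

(** The sum over the cells ]-L, 1[, the grid intervals of [1, Y] and ]Y, L[ of
    the probability of the cell times q, q M (left end point) and 1. *)
Definition cell_bound (R : realType) (q Y L : R) n : R :=
  q * fine (normal_prob 0 1 `]- L, 1[%classic) +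
  q * \sum_(j < n) M (grid Y n j) *
    fine (normal_prob 0 1 `]grid Y n j, grid Y n j.+1[%classic) +
  fine (normal_prob 0 1 `]Y, L[%classic).

(** The three errors are the two tails cut at L and the Riemann error. *)
Lemma ell_eq_le_cell_bound (R : realType) (q d : R) : 0 < q < 1 -> 0 < d ->
  exists L n, [/\ crit_y q < L, (0 < n)%N & ell_eq q <= cell_bound q (crit_y q) L n + d].
Proof.
move=> q01 d0; have [Y1 qM] := crit_y_spec q01; have /andP[q0 q1] := q01.
set Y := crit_y q in Y1 qM *.
have d30 : 0 < d / 3 by rewrite divr_gt0.
have [L0 tail] := exists_small_tail d30.
pose L := Num.max L0 (Y + 2).
have LL0 : L0 <= L by rewrite le_max lexx.
have LY : Y + 2 <= L by rewrite le_max lexx orbT.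
have {}tail := tail L LL0.
pose T := (Y - 1) * (M Y - 1) / (d / 3).
pose n := (Num.truncn T).+1.
have nR : 0 < n%:R :> R by rewrite ltr0n.
have Tn : T <= n%:R by rewrite ltW// truncnS_gt.
exists L, n; split => //; first lra.
set F : set (measurableTypeR R) := [set x | L - 1 < `|x - 0|] in tail *.
have mF : measurable F by exact: measurable_far.
have P1 : Phi 1 <= fine (normal_prob 0 1 `]- L, 1[%classic) + d / 3.
  have mA : measurable (`]- L, 1[%classic : set (measurableTypeR R)) by exact: measurable_itv.
  have mB : measurable (`[1, 1]%classic : set (measurableTypeR R)) by exact: measurable_itv.
  have sub : `]-oo, 1]%classic `<=` (`]- L, 1[%classic `|` F) `|` `[1, 1]%classic.
    move=> x; rewrite /F /= !in_itv/= subr0 => x1.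
    have [->|xn1] := eqVneq x 1; first by right; rewrite lexx.
    have [xL|xL] := leP x (- L); last by left; left; rewrite lt_neqAle xn1.
    by left; right; rewrite lter_normr; apply/orP; right; lra.
  have mAF := measurableU _ _ mA mF.
  rewrite /Phi; apply: (le_trans (normal_prob_subset 0 1 (measurable_itv _) (measurableU _ _ mAF mB) sub)).
  apply: (le_trans (normal_probU_le _ _ mAF mB)).
  have := normal_probU_le 0 1 mA mF.
  by have := @normal_prob_itv_le R 1 1 (lexx 1); rewrite subrr; lra.
have P2 : 1 - Phi Y <= fine (normal_prob 0 1 `]Y, L[%classic) + d / 3.
  have mA : measurable (`]Y, L[%classic : set (measurableTypeR R)) by exact: measurable_itv.
  have -> : 1 - Phi Y = fine (normal_prob 0 1 `]Y, +oo[%classic).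
    by have := pvalueE Y; rewrite /pvalue; lra.
  have sub : `]Y, +oo[%classic `<=` `]Y, L[%classic `|` F.
    move=> x; rewrite /F /= !in_itv/= subr0 andbT => Yx.
    have [xL|xL] := ltP x L; first by left; rewrite Yx.
    by right; rewrite lter_normr; apply/orP; left; lra.
  apply: (le_trans (normal_prob_subset 0 1 (measurable_itv _) (measurableU _ _ mA mF) sub)).
  by have := normal_probU_le 0 1 mA mF; lra.
have I := integral_M_le (n := n) isT (ltW Y1).
have J := riemann_M_le (n := n) isT (ltW Y1).
have E : (Y - 1) / n%:R * (M Y - 1) <= d / 3.
  move: Tn; rewrite /T ler_pdivrMr// => Tn.
  by rewrite mulrAC ler_pdivrMr// [_ * n%:R]mulrC.
rewrite /ell_eq -/Y /cell_bound; move: I J.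
set I := Rintegral _ _ _; set A := \sum_(j < n) _; set B := \sum_(j < n) _ => IA AB.
have qI : q * I <= q * (B + d / 3) by rewrite ler_pM2l//; lra.
have qP : q * Phi 1 <= q * (fine (normal_prob 0 1 `]- L, 1[%classic) + d / 3).
  by rewrite ler_pM2l.
have : q * (d / 3) <= d / 3 by rewrite ler_piMl ?(ltW d30)// ltW.
rewrite mulrDr in qI; rewrite mulrDr in qP; lra.
Qed.

(** * The theorem *)

(** The maximizer at 1 is a = 0, for which a/r does not tend to infinity; all
    maximizers are therefore shifted by some small al > 0, at this cost. *)
Lemma lik_ratio_shift_ge (R : realType) (a t z al Y : R) :
  0 <= a <= 2 * Y -> 0 <= al -> 0 <= t <= z ->
  expR (- (2 * Y * al + al ^+ 2 / 2)) * lik_ratio a t <= lik_ratio (a + al) z.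
Proof.
move=> /andP[a0 aY] al0 tz; have /andP[t0 tz'] := tz.
apply: (@le_trans _ _ (lik_ratio (a + al) t)); last first.
  by apply: le_lik_ratio => //; exact: addr_ge0.
rewrite /lik_ratio mulrA -expRD; apply: ler_pM; rewrite ?expR_ge0 ?(ltW (cosh_gt0 _))//.
  by rewrite ler_expR; nra.
apply: le_cosh; rewrite !normrM ler_wpM2r// !ger0_norm// ?addr_ge0//; lra.
Qed.

Lemma exists_shift (R : realType) (g Y : R) : 0 < g < 1 -> 0 <= Y ->
  exists2 al : R, 0 < al & g <= expR (- (2 * Y * al + al ^+ 2 / 2)).
Proof.
move=> /andP[g0 g1] Y0.
have d0 : 0 < - ln g by rewrite oppr_gt0 ln_lt0// g0.
have Y10 : 0 < 2 * Y + 1 by lra.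
pose al := Num.min 1 (- ln g / (2 * Y + 1)).
have al0 : 0 < al by rewrite lt_min ltr01 divr_gt0.
have al1 : al <= 1 by rewrite ge_min lexx.
have ald : al * (2 * Y + 1) <= - ln g by rewrite -ler_pdivlMr// ge_min lexx orbT.
exists al => //; rewrite -{1}[g]lnK ?posrE// ler_expR.
have : al ^+ 2 <= al by rewrite expr2 ler_piMr// ltW.
have := sqr_ge0 al; lra.
Qed.

(** The cells are those of [cell_bound].  On the cell k one takes
    1 - be_k = g^5 q v_k, where v_0 = 1 and v_k is M at the left end point; four
    factors g are consumed by [FDR_cells_ge] and one by the shift of the
    maximizers.  The sequences are continued constantly beyond the last cell. *)
Lemma FDR_cell_bound (R : realType) (q d L : R) n :
  0 < q < 1 -> 0 < d -> crit_y q < L -> (0 < n)%N ->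
  exists (N : nat) (theta : 'rV[R]_N) (Sigma : 'M[R]_N),
    [/\ (0 < N)%N, corrmx Sigma &
      ((cell_bound q (crit_y q) L n - d)%:E <= FDR q theta Sigma)%E].
Proof.
move=> q01 d0 YL n0; have [Y1 qM] := crit_y_spec q01; have /andP[q0 q1] := q01.
set Y := crit_y q in Y1 qM YL *; set S := cell_bound q Y L n.
have Y0 : 0 <= Y by rewrite (le_trans ler01)// ltW.
have S0 : 0 <= S.
  rewrite !addr_ge0 ?normal_prob_ge0// mulr_ge0 ?(ltW q0) ?normal_prob_ge0//.
  apply: sumr_ge0 => j _; rewrite mulr_ge0 ?normal_prob_ge0//.
  by rewrite (le_trans ler01)// M_ge1.
(* Bernoulli: 1 - g^5 <= 5 eta, so the factor g^5 costs at most d / 2. *)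
pose eta := Num.min (1 / 2) (d / (10 * (S + 1))).
have S10 : 0 < 10 * (S + 1) by rewrite mulr_gt0// ltr_wpDl.
have eta0 : 0 < eta by rewrite lt_min !divr_gt0.
have eta1 : eta <= 1 / 2 by rewrite ge_min lexx.
have etad : eta * (10 * (S + 1)) <= d by rewrite -ler_pdivlMr// ge_min lexx orbT.
pose g := 1 - eta.
have g01 : 0 < g < 1 by rewrite /g; apply/andP; split; lra.
have /andP[g0 g1] := g01.
have g5 : 1 - 5 * eta <= g ^+ 5.
  have h2 : 1 - 2 * eta <= g ^+ 2 by rewrite /g; have := sqr_ge0 eta; lra.
  have h4 : 1 - 4 * eta <= g ^+ 4.
    have : (1 - 2 * eta) ^+ 2 <= (g ^+ 2) ^+ 2.
      by rewrite lerXn2r ?nnegrE ?sqr_ge0//; lra.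
    rewrite -exprM; apply: le_trans; have := sqr_ge0 eta; lra.
  have : (1 - 4 * eta) * g <= g ^+ 4 * g by rewrite ler_wpM2r// ltW.
  by rewrite -exprSr; apply: le_trans; rewrite /g; have := sqr_ge0 eta; lra.
have g5S : (1 - g ^+ 5) * S <= d / 2.
  have : (1 - g ^+ 5) * S <= 5 * eta * S by rewrite ler_wpM2r//; lra.
  lra.
have [al al0 gal] := exists_shift g01 Y0.
have exa j : exists a : R, 0 <= a <= 2 * grid Y n j /\
    M (grid Y n j) = lik_ratio a (grid Y n j).
  have [|a aP aM] := @M_attained R (grid Y n j); last by exists a.
  by rewrite (le_trans ler01)// grid_ge1// ltW.
have [am amP] := boolp.choice exa.
have t1 j : 1 <= grid Y n j by rewrite grid_ge1// ltW.
have t0 j : 0 <= grid Y n j by rewrite (le_trans ler01).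
have tY j : grid Y n (minn j n) <= Y.
  by rewrite -{2}(grid_last Y n0); apply: le_grid; rewrite ?(ltW Y1)// geq_minr.
pose v k := if k is j.+1 then M (grid Y n (minn j n)) else 1.
pose a k := if k is j.+1 then am (minn j n) + al else al.
pose be k := 1 - g ^+ 5 * (q * v k).
pose y k := if k is j.+1 then (if (j <= n)%N then grid Y n j else L) else - L.
have tmono i j : (i <= j)%N -> grid Y n (minn i n) <= grid Y n (minn j n).
  by move=> ij; apply: le_grid; [exact: ltW|rewrite leq_min geq_minr andbT (leq_trans (geq_minl _ _))].
have v1 k : 1 <= v k by case: k => [|k] //=; exact: M_ge1.
have vq k : q * v k <= 1.
  case: k => [|k] /=; first by rewrite mulr1 ltW.
  by rewrite -qM ler_pM2l// le_M// tY t0.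
have hv : {homo v : i j / (i <= j)%N >-> i <= j}.
  move=> [|i] [|j] //= ij; first exact: M_ge1.
  by apply: le_M; rewrite t0 tmono.
have am_mono i j : (i < j <= n)%N -> am i <= am j.
  move=> /andP[ij jn]; have [/andP[i0 _] iM] := amP i; have [/andP[j0 _] jM] := amP j.
  apply: argmax_lik_ratio_mono iM jM => //; rewrite t0/= /grid ltrD2l.
  by rewrite ltr_pM2r ?ltr_nat// divr_gt0 ?ltr0n// subr_gt0.
have ha : {homo a : i j / (i <= j)%N >-> i <= j}.
  move=> [|i] [|j] //= ij; first by rewrite lerDr; have [/andP[]] := amP (minn j n).
  rewrite lerD2r; have [h|h] := ltnP (minn i n) (minn j n).
    by apply: am_mono; rewrite h geq_minr.
  rewrite (_ : minn i n = minn j n)//; apply/eqP; rewrite eqn_leq h andbT.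
  by rewrite leq_min geq_minr andbT (leq_trans (geq_minl _ _)).
have L1 : 1 <= L by rewrite ltW// (lt_trans Y1).
have gY j : (j <= n)%N -> grid Y n j <= Y.
  by move=> jn; rewrite -{2}(grid_last Y n0); apply: le_grid; rewrite ?(ltW Y1).
have hy : {homo y : i j / (i <= j)%N >-> i <= j}.
  move=> [|i] [|j] //= ij.
    by case: ifP => _; [rewrite (le_trans _ (t0 _))//; lra|lra].
  have [jn|jn] := leqP j n.
    by rewrite (leq_trans (ij : (i <= j)%N) jn); apply: le_grid; rewrite ?(ltW Y1).
  by have [i_n|//] := leqP i n; rewrite (le_trans (gY _ i_n))// ltW.
have yL k : `|y k| <= L.
  case: k => [|k] /=; first by rewrite normrN ger0_norm//; lra.
  by case: ifP => kn; rewrite ger0_norm ?(le_trans (gY _ kn)) ?(ltW YL)//; lra.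
have aA k : 0 < a k <= 2 * Y + al.
  case: k => [|k] /=; first by rewrite al0 lerDr mulr_ge0.
  have [/andP[h1 h2] _] := amP (minn k n); have := tY k.
  by move=> h; apply/andP; split; lra.
have g50 : 0 < g ^+ 5 by rewrite exprn_gt0.
have g51 : g ^+ 5 < 1 by rewrite exprn_ilt1// ltW.
have hbe : {homo be : i j / (i <= j)%N >-> j <= i}.
  by move=> i j ij; rewrite lerD2l lerN2 ler_pM2l// ler_pM2l// hv.
have beb k : 1 - g ^+ 5 <= be k <= 1 - g ^+ 5 * q.
  apply/andP; split; rewrite lerD2l lerN2.
    by rewrite ler_piMr// ltW.
  by rewrite ler_pM2l// ler_peMr// ltW.
have hL k z : (k < n.+2)%N -> y k < z < y k.+1 ->
    1 - be k <= g ^+ 4 * (q * lik_ratio (a k) z).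
  move=> kn /andP[yz _].
  have -> : 1 - be k = g ^+ 4 * (q * (g * v k)) by rewrite /be; ring.
  rewrite ler_pM2l ?exprn_gt0// ler_pM2l//.
  case: k => [|k] /= in kn yz *.
    rewrite mulr1 (le_trans gal)// /lik_ratio -[leLHS]mulr1.
    apply: ler_pM; rewrite ?expR_ge0 ?cosh_ge1// ler_expR.
    have : 0 <= 2 * Y * al by rewrite !mulr_ge0// ltW.
    lra.
  have kn' : (k <= n)%N by [].
  rewrite kn' in yz; have kE : minn k n = k by exact/minn_idPl.
  have [/andP[h1 h2] ->] := amP (minn k n).
  apply: (le_trans _ (@lik_ratio_shift_ge R _ (grid Y n (minn k n)) _ _ Y _ (ltW al0) _)).
  - by rewrite ler_wpM2r// ltW// lik_ratio_gt0.
  - by rewrite h1 (le_trans h2)// ler_pM2l.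
  - by rewrite t0 kE ltW.
have bm0 : 0 < 1 - g ^+ 5 by rewrite subr_gt0.
have bM1 : 1 - g ^+ 5 * q < 1 by rewrite ltrBlDr ltrDl mulr_gt0.
have d20 : 0 < d / 2 by rewrite divr_gt0.
have [N [theta [Sigma [N0 hS hF]]]] := FDR_cells_ge q0 g01 d20 hy ha hbe yL aA bm0 bM1 beb hL.
exists N, theta, Sigma; split => //; apply: le_trans hF; rewrite lee_fin.
have -> : \sum_(k < n.+2) (1 - be k) * fine (normal_prob 0 1 `]y k, y k.+1[%classic) =
    g ^+ 5 * S.
  rewrite big_ord_recl big_ord_recr/= /be /= /bump /= !add1n /= leqnn ltnn minnn grid0 grid_last//.
  rewrite /S /cell_bound -/Y mulr_sumr qM.
  rewrite [in RHS]mulrDr [in RHS]mulrDr [in RHS]mulr_sumr -[RHS]addrA.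
  congr (_ + (_ + _)); [by ring| |by ring].
  apply: eq_bigr => i _.
  rewrite -[LHS]/((1 - (1 - g ^+ 5 * (q * M (grid Y n (minn i n))))) *
    fine (normal_prob 0 1 `]if (i <= n)%N then grid Y n i else L,
      if (i < n)%N then grid Y n i.+1 else L[%classic)).
  by rewrite ltn_ord (ltnW (ltn_ord i)) (minn_idPl (ltnW (ltn_ord i))); ring.
lra.
Qed.

Theorem theorem2p1 (R : realType) (q : R) (hq : 0 < q < 1) :
  (forall delta : R, 0 < delta ->
     exists (N : nat) (theta : 'rV[R]_N) (Sigma : 'M[R]_N),
       [/\ (0 < N)%N, corrmx Sigma &
           ((ell_eq q - delta)%:E < FDR q theta Sigma)%E]) /\
  ((ell_eq q)%:E <=
     ereal_sup [set r | exists (N : nat) (theta : 'rV[R]_N) (Sigma : 'M[R]_N),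
                  [/\ (0 < N)%N, corrmx Sigma & r = FDR q theta Sigma]])%E.
Proof.
have main (delta : R) : 0 < delta ->
    exists (N : nat) (theta : 'rV[R]_N) (Sigma : 'M[R]_N),
      [/\ (0 < N)%N, corrmx Sigma & ((ell_eq q - delta)%:E < FDR q theta Sigma)%E].
  move=> d0; have d30 : 0 < delta / 3 by rewrite divr_gt0.
  have [L [n [YL n0 ell]]] := ell_eq_le_cell_bound hq d30.
  have [N [theta [Sigma [N0 hS hF]]]] := FDR_cell_bound hq d30 YL n0.
  exists N, theta, Sigma; split=> //; apply: lt_le_trans hF.
  by rewrite lte_fin; lra.
split=> //; apply/lee_addgt0Pr => e e0.
have [N [theta [Sigma [N0 hS hF]]]] := main e e0.
rewrite -leeBlDr// -EFinB (le_trans (ltW hF))//.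
by apply: ereal_sup_ubound; exists N, theta, Sigma.
Qed.
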